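(* For every function $p=p(n)\in[0,1]$, asymptotically almost surely (i.e. with probability tending to $1$ as $n\to\infty$) \[ T(\mathcal G(n,p))=\min\Big\{\delta(\mathcal G(n,p)),\ \Big\lfloor \frac{m(\mathcal G(n,p))}{n-1}\Big\rfloor\Big\}. \]
   Context: $\mathcal G(n,p)$ is the Erdős–Rényi random graph on vertex set $[n]=\{1,\dots,n\}$ in which each of the $\binom n2$ possible edges is present independently with probability $p$. For a graph $G$, $m(G)$ denotes its number of edges, $\delta(G)$ its minimum degree, and $T(G)$ its spanning-tree packing number, i.e. the maximum number of pairwise edge-disjoint spanning trees of $G$ (this is $0$ if $G$ is disconnected). *)

(* Defs.v *)
From HB Require Import structures.
From mathcomp Require Import all_boot all_order all_algebra.
From mathcomp Require Import all_classical all_reals all_analysis.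
Set Implicit Arguments. Unset Strict Implicit. Unset Printing Implicit Defensive.
Import Order.TTheory GRing.Theory Num.Theory.

(* A simple graph on vertex set 'I_n ({0..n-1}, i.e. [n]) is a set E of
   2-element subsets of 'I_n (its edge set). *)

Definition all_edges (n : nat) : {set {set 'I_n}} := [set e : {set 'I_n} | #|e| == 2].

Definition adj (n : nat) (E : {set {set 'I_n}}) : rel 'I_n :=
  fun x y => [set x; y] \in E.

Definition nedges (n : nat) (E : {set {set 'I_n}}) : nat := #|E|.

Definition deg (n : nat) (E : {set {set 'I_n}}) (v : 'I_n) : nat :=
  #|[set e in E | v \in e]|.

(* delta(G): minimum degree (convention: n for the empty vertex set n = 0). *)
Definition mindeg (n : nat) (E : {set {set 'I_n}}) : nat :=
  \big[minn/n]_(v : 'I_n) deg E v.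

Definition connected_graph (n : nat) (T : {set {set 'I_n}}) : Prop :=
  forall x y : 'I_n, connect (adj T) x y.

Definition acyclic_graph (n : nat) (T : {set {set 'I_n}}) : Prop :=
  forall c : seq 'I_n, 2 < size c -> uniq c -> ~~ cycle (adj T) c.

Definition spanning_tree (n : nat) (E T : {set {set 'I_n}}) : Prop :=
  [/\ T \subset E, connected_graph T & acyclic_graph T].

Definition packable (n : nat) (E : {set {set 'I_n}}) (k : nat) : Prop :=
  exists F : 'I_k -> {set {set 'I_n}},
    (forall i, spanning_tree E (F i)) /\
    (forall i j, i != j -> [disjoint F i & F j]).

(* T(G): spanning-tree packing number = max number of pairwise edge-disjoint
   spanning trees (0 if G is disconnected).  For n >= 2 every spanning tree
   has >= 1 edge, so this number is <= #|E| and the range bound below is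
   harmless. *)
Definition stp (n : nat) (E : {set {set 'I_n}}) : nat :=
  \max_(k < #|E|.+1 | `[< packable E k >]) k.

Definition gnp_prob (R : realType) (n : nat) (p : R)
    (P : {set {set 'I_n}} -> Prop) : R :=
  (\sum_(E in powerset (all_edges n) | `[< P E >])
     p ^+ #|E| * (1 - p) ^+ (#|all_edges n| - #|E|))%R.

Definition stp_event (n : nat) (E : {set {set 'I_n}}) : Prop :=
  stp E = minn (mindeg E) (nedges E %/ n.-1).

(* Main.v *)
(* Let t be the minimum of the minimum degree and of floor(m / (n - 1)).  At most t disjoint spanning
   trees exist for trivial reasons; by the Nash-Williams--Tutte theorem t of them exist as soon as
   every partition into k parts has at least t (k - 1) crossing edges.

   If no part has almost all the vertices, every part S spans at most m (|S| - 1) / (n - 1) edges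
   (small sets are sparse, the others are concentrated), and removing these edges from m gives the
   bound.  If one part is huge, the others live on a small sparse set, where vertices of degree well
   above t pay for themselves; the remaining "low" vertices have degree at least t and are pairwise
   at distance at least 3, so their stars do not interfere.

   That low vertices are far apart is where the choice of t matters.  If p n >= 40 ln n then
   t <= (1/2 + o(1)) p n, so low vertices are rare by a Chernoff bound.  Otherwise let x be least such
   that the expected number of vertices of degree at most x is at least n^(1/10): by the second moment
   method t <= x, while adding a small multiple of ln n to x - 1 multiplies the expected number of
   vertices of such a degree by at most a small power of n.  When x = 0, there is an isolated vertex
   with high probability, and then t = 0. *)

Require Import Defs.
From HB Require Import structures.
From mathcomp Require Import all_boot all_order all_algebra.
From mathcomp Require Import zify ring lra.
From mathcomp Require Import boolp reals sequences exp.
Set Implicit Arguments.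
Unset Strict Implicit.
Unset Printing Implicit Defensive.
Import Order.TTheory GRing.Theory Num.Theory.

(** * Matroid intersection *)

Section MatroidIntersection.
Variable T : finType.
Implicit Types (r : {set T} -> nat) (A B S : {set T}) (x : T).

Definition rank_function r : Prop :=
  [/\ r set0 = 0, forall A B, A \subset B -> r A <= r B,
      forall A B, r (A :|: B) + r (A :&: B) <= r A + r B
    & forall x, r [set x] <= 1].

Lemma rank_function_loops r S :
  rank_function r -> (forall x, x \in S -> r [set x] = 0) -> r S = 0.
Proof.
move=> [r0 rmono rsub _] loops.
suff H k : forall A, A \subset S -> #|A| = k -> r A = 0 by exact: H (subxx S) erefl.
elim: k => [A _ /eqP|k IH A AS Ak]; first by rewrite cards_eq0 => /eqP ->.
have /card_gt0P[x xA] : 0 < #|A| by rewrite Ak.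
have IA : r (A :\ x) = 0.
  apply: IH; first exact: subset_trans (subD1set _ _) AS.
  by have := cardsD1 x A; rewrite xA Ak => -[].
by have := rsub [set x] (A :\ x); rewrite setD1K // loops ?(subsetP AS) // IA; lia.
Qed.

(** For a rank function the truncated subtraction is exact, by monotonicity. *)
Definition contract r x A := r (x |: A) - r [set x].

Lemma contract_rank_function r x :
  rank_function r -> rank_function (contract r x).
Proof.
move=> [r0 rmono rsub r1]; rewrite /contract; split.
- by rewrite setU0 subnn.
- by move=> A B AB; rewrite leq_sub2r // rmono // setUS.
- move=> A B.
  have := rsub (x |: A) (x |: B).
  have -> : (x |: A) :|: (x |: B) = x |: (A :|: B) by rewrite -setUUr.
  have -> : (x |: A) :&: (x |: B) = x |: (A :&: B) by rewrite -setUIr.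
  have H C : r [set x] <= r (x |: C) by apply: rmono; rewrite subsetUl.
  have := H A; have := H B; have := H (A :|: B); have := H (A :&: B).
  lia.
- move=> y; have := rsub [set x] [set y]; have := r1 y; lia.
Qed.

(* If neither deleting x nor contracting x preserves the hypothesis, the two violating
   bipartitions uncross, by submodularity, into two bipartitions of S one of which violates it. *)
Theorem matroid_intersection r1 r2 S k :
  rank_function r1 -> rank_function r2 ->
  (forall A, A \subset S -> k <= r1 A + r2 (S :\: A)) ->
  exists I : {set T}, [/\ I \subset S, k <= #|I|, r1 I = #|I| & r2 I = #|I|].
Proof.
have [N] := ubnP #|S|.
elim: N r1 r2 S k => // N IH r1 r2 S k SN rf1 rf2 hk.
have [e1|] := boolP [exists x in S, (r1 [set x] == 1) && (r2 [set x] == 1)];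
  last first.
  rewrite negb_exists_in => /forall_inP noe.
  exists set0; rewrite sub0set cards0; case: (rf1) (rf2) => -> _ _ l1 [-> _ _ l2].
  split=> //.
  (* Every element of [S] is now a loop of one of the two matroids; splitting [S] accordingly gives
     total rank 0, hence [k = 0]. *)
  pose A := [set x in S | r1 [set x] == 0].
  have AS : A \subset S by apply/subsetP => x; rewrite inE => /andP[].
  have -> : 0 = r1 A + r2 (S :\: A); last exact: hk.
  rewrite !rank_function_loops //.
  - move=> x; rewrite !inE => /andP[+ xS]; rewrite xS /= => r1x.
    have := noe x xS; have := l1 x; have := l2 x; lia.
  - by move=> x; rewrite inE => /andP[_ /eqP].
have {e1} [x xS /andP[/eqP r1x /eqP r2x]] := exists_inP e1.
have S'N : #|S :\ x| < N by have := cardsD1 x S; rewrite xS; lia.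
have S'S : S :\ x \subset S by apply: subD1set.
have [hdel|] := boolP [forall A : {set T}, (A \subset S :\ x) ==>
    (k <= r1 A + r2 ((S :\ x) :\: A))].
  have [|I [IS *]] := IH r1 r2 (S :\ x) k S'N rf1 rf2.
    by move=> A AS; have /forallP/(_ A) := hdel; rewrite AS.
  by exists I; split=> //; apply: subset_trans IS S'S.
rewrite negb_forall => /existsP[A]; rewrite negb_imply -ltnNge => /andP[AS hA].
have [hcon|] := boolP [forall C : {set T}, (C \subset S :\ x) ==>
    (k.-1 <= contract r1 x C + contract r2 x ((S :\ x) :\: C))].
  have [|I [IS kI I1 I2]] := IH _ _ (S :\ x) k.-1 S'N
      (contract_rank_function x rf1) (contract_rank_function x rf2).
    by move=> C CS; have /forallP/(_ C) := hcon; rewrite CS.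
  have xI : x \notin I by apply/negP => /(subsetP IS); rewrite !inE eqxx.
  case: (rf1) (rf2) => _ m1 _ _ [_ m2 _ _].
  have := m1 [set x] (x |: I) (subsetUl _ _).
  have := m2 [set x] (x |: I) (subsetUl _ _).
  exists (x |: I); rewrite cardsU1 xI; move: I1 I2; rewrite /contract r1x r2x.
  split; [|lia..].
  by rewrite subUset sub1set xS (subset_trans IS).
rewrite negb_forall => /existsP[C]; rewrite negb_imply -ltnNge => /andP[CS hC].
exfalso; set B := _ :\: A in hA; set D := _ :\: C in hC.
(* The uncrossed bipartitions have first sides [x |: (A :|: C)] and [A :&: C]. By submodularity
   their total ranks add up to at most [(k - 1) + k], while the hypothesis gives at least
   [2 * k]. *)
have P1 : S :\: (x |: (A :|: C)) = B :&: D.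
  by apply/setP => y; rewrite !inE; do ![case: (_ \in _) | case: (_ == _)].
have P2 : S :\: (A :&: C) = x |: (B :|: D).
  apply/setP => y; rewrite !inE; case: (eqVneq y x) => [->|] /=.
    by rewrite xS andbT; apply/nandP; left; apply/negP => /(subsetP AS); rewrite !inE eqxx.
  by do ![case: (_ \in _)].
have := hk (x |: (A :|: C)); have := hk (A :&: C); rewrite P1 P2.
rewrite (subset_trans (subsetIl _ _) (subset_trans AS S'S)) => /(_ isT) k1.
rewrite !subUset sub1set xS (subset_trans AS S'S) (subset_trans CS S'S) => /(_ isT) k2.
case: (rf1) (rf2) => _ m1 s1 _ [_ m2 s2 _].
have := s1 A (x |: C); have := s2 B (x |: D).
have xA : x \notin A by apply/negP => /(subsetP AS); rewrite !inE eqxx.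
have xB : x \notin B by rewrite !inE eqxx andbF.
have E A' C' : x \notin A' -> A' :&: (x |: C') = A' :&: C'.
  move=> xA'; apply/setP => y; rewrite !inE.
  by case: (eqVneq y x) => // ->; rewrite (negPf xA').
rewrite !(setUCA _ [set x]) !E //.
have := m1 [set x] (x |: C) (subsetUl _ _); have := m2 [set x] (x |: D) (subsetUl _ _).
move: hC; rewrite /contract r1x r2x; lia.
Qed.

End MatroidIntersection.

(** * The tree-packing theorem of Nash-Williams and Tutte *)

Lemma mxrank_sum_rV (F : fieldType) (I : finType) (P : {pred I}) n (v : I -> 'rV[F]_n) :
  \rank (\sum_(i in P) <<v i>>)%MS <= #|P|.
Proof.
rewrite -sum1_card; elim/big_rec2: _ => [|i r M _ IH]; first by rewrite mxrank0.
rewrite (leq_trans (mxrank_adds_leqif _ _)) // leq_add // genmxE.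
exact: rank_leq_row.
Qed.

Section TreePacking.
Variable n : nat.
Implicit Types (D E : {set {set 'I_n}}) (e : {set 'I_n}) (x y : 'I_n).

Local Notation unitv x := (@delta_mx 'F_2 1 n 0%R x).

(** Incidence vectors over the two-element field represent the graphic matroid without orienting
    edges, so submodularity of its rank is a fact about dimensions of subspaces. *)
Definition incidence e : 'rV['F_2]_n := (\row_w (w \in e)%:R)%R.

Definition incidence_span D : 'M['F_2]_n := (\sum_(e in D) <<incidence e>>)%MS.

Definition graphic_rank D := \rank (incidence_span D).

Lemma incidence_pair x y : x != y ->
  incidence [set x; y] = (unitv x + unitv y)%R.
Proof.
move=> xy; apply/rowP => w; rewrite !mxE !inE eqxx /=.
by case: (eqVneq w x) => [->|_]; rewrite ?(negPf xy) ?addr0 ?add0r.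
Qed.

Lemma incidence_sub_span D e : e \in D -> (incidence e <= incidence_span D)%MS.
Proof. by move=> eD; rewrite (sumsmx_sup e) ?genmxE. Qed.

Lemma incidence_span_sub D m (M : 'M_(m, n)) :
  (forall e, e \in D -> (incidence e <= M)%MS) -> (incidence_span D <= M)%MS.
Proof. by move=> H; apply/sumsmx_subP => e /H; rewrite genmxE. Qed.

Lemma graphic_rank_function : rank_function graphic_rank.
Proof.
have mono (A B : {set {set 'I_n}}) : A \subset B -> (incidence_span A <= incidence_span B)%MS.
  by move=> /subsetP AB; apply: incidence_span_sub => e /AB /incidence_sub_span.
split.
- by rewrite /graphic_rank /incidence_span big_set0 mxrank0.
- by move=> A B AB; apply/mxrankS/mono.
- move=> A B; rewrite /graphic_rank -(mxrank_sum_cap (incidence_span A)) leq_add // mxrankS //.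
    apply: incidence_span_sub => e; rewrite inE => /orP[] /incidence_sub_span H;
      apply: submx_trans H _; [exact: addsmxSl|exact: addsmxSr].
  by rewrite sub_capmx !mono ?subsetIl ?subsetIr.
- by move=> e; rewrite /graphic_rank /incidence_span big_set1 genmxE rank_leq_row.
Qed.

Lemma graphic_rank_card D : graphic_rank D <= #|D|.
Proof. exact: mxrank_sum_rV. Qed.

Lemma F2_double m (v : 'rV['F_2]_m) : (v + v = 0)%R.
Proof. by apply/rowP => i; rewrite !mxE; apply/eqP; case: (v 0%R i) => -[|[]]. Qed.

(** The edge vectors along a path telescope, since [v + v = 0]. *)
Lemma connect_span D x y : connect (adj D) x y ->
  ((unitv x + unitv y)%R <= incidence_span D)%MS.
Proof.
move=> /connectP[p + ->]; elim: p x => [x _|z p IH x] /=.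
  by rewrite F2_double sub0mx.
move=> /andP[xz /IH H].
have -> : (unitv x + unitv (last z p) = (unitv x + unitv z) +
   (unitv z + unitv (last z p)))%R.
  rewrite -addrA [(unitv z + (_ + _))%R]addrA. by rewrite F2_double add0r.
rewrite addmx_sub //; have [->|zx] := eqVneq x z; first by rewrite F2_double sub0mx.
by rewrite -incidence_pair // incidence_sub_span.
Qed.

(** The span of [D] and the unit vectors of the labels generate everything, because
    [x = (x + c x) + c x]. *)
Lemma graphic_rank_labelling D (c : 'I_n -> 'I_n) :
  (forall x, connect (adj D) x (c x)) -> n <= graphic_rank D + #|c @: setT|.
Proof.
move=> cP; set J := c @: setT.
pose W := (\sum_(j in J) <<unitv j>>)%MS.
have rW : \rank W <= #|J| by exact: mxrank_sum_rV.
have full : ((1%:M)%R <= incidence_span D + W)%MS.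
  apply/row_subP => x; rewrite rowE mulmx1.
  have -> : (unitv x = (unitv x + unitv (c x)) + unitv (c x))%R.
    by rewrite -addrA F2_double addr0.
  apply: addmx_sub; first exact: submx_trans (connect_span (cP x)) (addsmxSl _ _).
  apply: submx_trans (addsmxSr _ _).
  by rewrite (sumsmx_sup (c x)) ?genmxE // imset_f.
have := mxrankS full; rewrite mxrank1 => /leq_trans; apply.
by rewrite (leq_trans (mxrank_adds_leqif _ _)) // leq_add2l.
Qed.

(** Rank-nullity: independent columns orthogonal to all edges bound the rank from above. *)
Lemma graphic_rank_annihilator D q (M : 'M['F_2]_(n, q)) :
  (forall e, e \in D -> (incidence e *m M = 0)%R) -> graphic_rank D + \rank M <= n.
Proof.
move=> H; have : (incidence_span D <= kermx M)%MS.
  by apply: incidence_span_sub => e /H/sub_kermxP.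
by move/mxrankS; rewrite mxrank_ker /graphic_rank; have := rank_leq_row M; lia.
Qed.

Lemma edgeP D e : D \subset all_edges n -> e \in D ->
  exists x y, x != y /\ e = [set x; y].
Proof.
move=> /subsetP H /H; rewrite inE => /cards2P[x [y [xy ->]]]; by exists x, y.
Qed.

Lemma adj_sym D : symmetric (adj D).
Proof. by move=> x y; rewrite /adj setUC. Qed.

Lemma graphic_rank_lt D : 0 < n -> D \subset all_edges n -> graphic_rank D < n.
Proof.
move=> n0 DE; have := @graphic_rank_annihilator D 1 (const_mx 1%R).
have -> : \rank (const_mx 1%R : 'M['F_2]_(n, 1)) = 1.
  apply/eqP; rewrite eqn_leq rank_leq_col lt0n mxrank_eq0.
  by apply/eqP => /matrixP/(_ (Ordinal n0) 0%R); rewrite !mxE.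
rewrite addn1; apply=> e /(edgeP DE)[x [y [xy ->]]].
by rewrite incidence_pair // mulmxDl -!rowE !row_const F2_double.
Qed.

(** If [x] does not reach [y], the indicators of the component of [x] and of its complement
    annihilate all edges, and the rank is at most [n - 2]. *)
Lemma graphic_rank_connected D : D \subset all_edges n -> n.-1 <= graphic_rank D ->
  connected_graph D.
Proof.
move=> DE rD x y; apply/negPn/negP => nxy; set C := connect (adj D) x in nxy.
pose M : 'M['F_2]_(n, 2) := (\matrix_(w, j) (C w == (j == 0%R))%:R)%R.
have Cx : C x by exact: connect0.
suff /graphic_rank_annihilator : forall e, e \in D -> (incidence e *m M = 0)%R.
  suff -> : \rank M = 2 by move: rD; have := ltn_ord x; lia.
  apply/eqP; rewrite eqn_leq rank_leq_col /=.
  (* [N] extracts the rows [x] and [y] of [M], which form the identity matrix. *)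
  pose N : 'M['F_2]_(2, n) := (\matrix_(j, w) (w == if j == 0%R then x else y)%:R)%R.
  suff r2 : \rank (N *m M)%R = 2 by rewrite -[X in (X <= _)%N]r2 mxrankM_maxr.
  suff -> : (N *m M = 1%:M)%R by rewrite mxrank1.
  apply/matrixP => i j; rewrite !mxE.
  rewrite (bigD1 (if i == 0 then x else y)%R) //= big1 => [|w wi].
    by rewrite !mxE eqxx mul1r addr0; case: i => -[|[]] // ?; case: j => -[|[]] // ?;
      rewrite /= ?Cx ?(negPf nxy).
  by rewrite !mxE (negPf wi) mul0r.
move=> e eD; have [u [v [uv eE]]] := edgeP DE eD.
have Cuv : C u = C v.
  by rewrite /C; apply: same_connect_r; [exact: sym_connect_sym (adj_sym D)|
    apply: connect1; rewrite /adj -eE].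
rewrite eE incidence_pair // mulmxDl -!rowE.
suff -> : row u M = row v M by rewrite F2_double.
by apply/rowP => j; rewrite !mxE Cuv.
Qed.

(** An edge of a cycle lies in the span of the other edges, so a cycle would push the rank below the
    number of edges. *)
Lemma graphic_rank_acyclic D : graphic_rank D = #|D| -> acyclic_graph D.
Proof.
move=> rD [|x [|z [|w p]]] // _; set q := w :: p => uc; apply/negP.
rewrite /cycle rcons_cons /= rcons_path => /andP[xz /andP[zw /andP[wp yx]]].
have pq : path (adj D) z q by rewrite /= zw.
set y := last z q in yx; set e := [set y; x].
have yq : y \in q by rewrite /y /q /=; exact: mem_last.
move: uc; rewrite cons_uniq inE negb_or => /andP[/andP[nxz xq] /andP[zq _]].
have yx' : y != x by apply: contraNneq xq => <-.
(* The rest of the cycle joins [x] to [y] without [e]: its first edge differs from [e] because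
   [z != y], and its other edges miss [x]. *)
have con : connect (adj (D :\ e)) x y.
  apply: (connect_trans (y := z)).
    apply: connect1; rewrite /adj in_setD1 (xz : [set x; z] \in D) andbT; apply: contraTneq yq => /setP/(_ z).
    by rewrite !inE eqxx orbT [z == x]eq_sym (negPf nxz) orbF => /esym/eqP <-.
  apply/connectP; exists q => //.
  have subr : {in [pred u | u != x] &, subrel (adj D) (adj (D :\ e))}.
    move=> u v; rewrite !inE => ux vx; rewrite /adj in_setD1 => ->; rewrite andbT.
    apply/eqP => /setP/(_ x); rewrite !inE eqxx orbT.
    by rewrite eq_sym (negPf ux) eq_sym (negPf vx).
  apply: (sub_in_path subr _ pq).
  apply/allP => u; rewrite inE => /orP[/eqP ->|uq] /=; first by rewrite eq_sym.
  by apply: contraNneq xq => <-.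
have sub : (incidence_span D <= incidence_span (D :\ e))%MS.
  apply: incidence_span_sub => f fD; have [->|fe] := eqVneq f e.
    by rewrite incidence_pair // addrC connect_span.
  by rewrite incidence_sub_span // in_setD1 fe.
have := leq_trans (mxrankS sub) (graphic_rank_card (D :\ e)).
by rewrite -/(graphic_rank D) rD [#|D|](cardsD1 e) (yx : e \in D) ltnn.
Qed.

(* Partitions are encoded as labellings c, the parts being the nonempty fibres.  The theorem is
   matroid intersection on E x 'I_k, between k copies of the graphic matroid and the matroid in
   which every edge is used at most once. *)
Theorem nash_williams_tutte E k : E \subset all_edges n ->
  (forall c : 'I_n -> 'I_n,
     k * #|c @: setT|.-1 <= #|[set e in E | [exists x in e, exists y in e, c x != c y]]|) ->
  packable E k.
Proof.
move=> EA H.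
pose fiber (A : {set {set 'I_n} * 'I_k}) i := [set e | (e, i) \in A].
pose r1 A := \sum_(i < k) graphic_rank (fiber A i).
pose r2 (A : {set {set 'I_n} * 'I_k}) := #|fst @: A|.
pose S := setX E [set: 'I_k].
have [g0 gm gs g1] := graphic_rank_function.
have rf1 : rank_function r1.
  split.
  - by apply: big1 => i _; rewrite -[RHS]g0; congr graphic_rank; apply/setP => e; rewrite !inE.
  - move=> A B /subsetP AB; apply: leq_sum => i _; apply: gm.
    by apply/subsetP => e; rewrite !inE => /AB.
  - move=> A B; rewrite -!big_split /=; apply: leq_sum => i _.
    have -> : fiber (A :|: B) i = fiber A i :|: fiber B i by apply/setP => e; rewrite !inE.
    have -> : fiber (A :&: B) i = fiber A i :&: fiber B i by apply/setP => e; rewrite !inE.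
    exact: gs.
  - move=> [e i]; rewrite /r1 (bigD1 i) //= big1 ?addn0 => [|j ji].
      by apply: leq_trans (g1 e); apply: gm; apply/subsetP => f; rewrite !inE => /eqP[->].
    rewrite -[RHS]g0; congr graphic_rank; apply/setP => f; rewrite !inE.
    by rewrite xpair_eqE (negPf ji) andbF.
have rf2 : rank_function r2.
  split.
  - by rewrite /r2 imset0 cards0.
  - by move=> A B AB; apply/subset_leq_card/imsetS.
  - move=> A B; rewrite /r2 imsetU -(cardsUI (fst @: A)) leq_add2l subset_leq_card //.
    by rewrite subsetI !imsetS ?subsetIl ?subsetIr.
  - by move=> x; rewrite /r2 imset_set1 cards1.
have [|I [IS kI I1 I2]] := @matroid_intersection _ r1 r2 S (k * n.-1) rf1 rf2.
  (* [D] collects the edges all of whose copies lie in [A]: every layer of [A] has at least the rank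
     of [D], and every edge outside [D] counts in [r2]. *)
  move=> A AS; pose D := [set e in E | [forall i, (e, i) \in A]].
  have DE : D \subset E by apply/subsetP => e; rewrite inE => /andP[].
  have DA : D \subset all_edges n := subset_trans DE EA.
  have rA : k * graphic_rank D <= r1 A.
    have -> : k * graphic_rank D = \sum_(i < k) graphic_rank D by rewrite sum_nat_const card_ord.
    apply: leq_sum => i _; apply: gm.
    by apply/subsetP => e; rewrite !inE => /andP[_ /forallP/(_ i)].
  have rS : #|E :\: D| <= r2 (S :\: A).
    apply/subset_leq_card/subsetP => e; rewrite !inE => /andP[+ eE]; rewrite eE /=.
    rewrite negb_forall => /existsP[i ei]; apply/imsetP; exists (e, i) => //.
    by rewrite !inE ei eE.
  have symD := sym_connect_sym (adj_sym D).
  (* The parts are the components of [D], so crossing edges lie outside [D], and the rank of [D]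
     plus the number of parts is at least [n]. *)
  pose c := fingraph.root (adj D).
  have cP x : connect (adj D) x (c x) by apply: connect_root.
  have := graphic_rank_labelling cP; have := H c.
  set cr := [set e in E | _] => kc nr.
  have crD : #|cr| <= #|E :\: D|.
    apply/subset_leq_card/subsetP => e; rewrite inE => /andP[eE /exists_inP[x xe]].
    move=> /exists_inP[y ye cxy]; rewrite in_setD eE andbT; apply: contraNN cxy => eD.
    rewrite root_connect //; have [u [v [_ eV]]] := edgeP DA eD.
    move: xe ye; rewrite eV !inE => /orP[] /eqP -> /orP[] /eqP ->;
      rewrite ?connect0 //; [|rewrite symD]; by apply: connect1; rewrite /adj -eV.
  apply: leq_trans (_ : k * graphic_rank D + k * #|c @: setT|.-1 <= _).
    by rewrite -mulnDr leq_mul2l; apply/orP; right; move: nr; lia.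
  exact: leq_add rA (leq_trans kc (leq_trans crD rS)).
exists (fiber I); have fE i : fiber I i \subset E.
  apply/subsetP => e; rewrite inE => /(subsetP IS); by rewrite !inE andbT.
have sumI : #|I| = \sum_(i < k) #|fiber I i|.
  rewrite -sum1_card (partition_big snd predT) //=; apply: eq_bigr => i _.
  have inj : injective (fun e : {set 'I_n} => (e, i)) by move=> e f [].
  rewrite -(card_imset _ inj) -sum1_card; apply: eq_bigl => -[e j] /=.
  apply/andP/imsetP => [[eI /eqP <-]|[f + [-> ->]]]; first by exists e; rewrite ?inE.
  by rewrite inE.
(* Each layer has rank at most its size and the totals agree, so no layer has a deficit. *)
have rfib i : graphic_rank (fiber I i) = #|fiber I i|.
  apply/eqP; rewrite eqn_leq graphic_rank_card /=.
  have := I1; rewrite sumI /r1 (bigD1 i) //= [RHS](bigD1 i) //= => /eqP.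
  apply: contraTT; rewrite -ltnNge => lti; rewrite neq_ltn -addSn leq_add //.
  by apply: leq_sum => j _; apply: graphic_rank_card.
have le i : graphic_rank (fiber I i) <= n.-1.
  have [n0|n0] := posnP n; first by rewrite (leq_trans (rank_leq_row _)) // [X in (X <= _)%N]n0.
  by rewrite -ltnS prednK // graphic_rank_lt // (subset_trans (fE i) EA).
(* The total is at least [k * n.-1] and no layer exceeds [n.-1], so every layer attains it. *)
have ge i : n.-1 <= graphic_rank (fiber I i).
  have : \sum_(j < k | j != i) graphic_rank (fiber I j) <= k.-1 * n.-1.
    apply: leq_trans (_ : \sum_(j < k | j != i) n.-1 <= _).
      by apply: leq_sum => j _; apply: le.
    by rewrite sum_nat_const leq_mul2r cardC1 card_ord leqnn orbT.
  have := kI; rewrite -I1 /r1 (bigD1 i) //= => kI' rest.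
  rewrite -(leq_add2r (k.-1 * n.-1)) -mulSn prednK ?(leq_trans _ (ltn_ord i)) //.
  by apply: leq_trans kI' _; rewrite leq_add2l.
split=> [i|i j ij].
  split; first exact: fE.
    by apply: graphic_rank_connected => //; apply: subset_trans (fE i) EA.
  exact: graphic_rank_acyclic.
(* Equality in [r2] means that [fst] is injective on [I]: no edge serves two layers. *)
rewrite -setI_eq0; apply/eqP/setP => e; rewrite !inE; apply/negP => /andP[ei ej].
have [] := imset_injP (introT eqP I2) _ _ ei ej erefl.
by move=> eij; rewrite eij eqxx in ij.
Qed.

End TreePacking.

Lemma sum_card_disjoint (I T : finType) (P : {set I}) (F : I -> {set T}) (X : {set T}) :
  (forall i, i \in P -> F i \subset X) ->
  (forall i j x, i \in P -> j \in P -> x \in F i -> x \in F j -> i = j) ->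
  \sum_(i in P) #|F i| <= #|X|.
Proof.
move=> FX disj.
under eq_bigr do rewrite -sum1_card.
rewrite (exchange_big_dep (mem X)) /= => [|i x iP xF]; last exact: (subsetP (FX i iP)).
rewrite -sum1_card; apply: leq_sum => x _; rewrite sum1dep_card.
rewrite -(cards1 x); have [->|[i]] := set_0Vmem [set i in P | x \in F i].
  by rewrite cards0.
rewrite inE => /andP[iP xi]; rewrite cards1 -(cards1 i); apply/subset_leq_card/subsetP => j.
by rewrite !inE => /andP[jP xj]; apply/eqP; apply: disj xi.
Qed.

(** * A deterministic sufficient condition *)

Section Deterministic.
Variable n : nat.
Implicit Types (D E T : {set {set 'I_n}}) (e : {set 'I_n}) (u v w : 'I_n).
Implicit Types (S H : {set 'I_n}).

Definition induced E S := [set e in E | e \subset S].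

(** A constant labelling has a single class, and the rank is at most the number of edges. *)
Lemma connected_card D : connected_graph D -> n.-1 <= #|D|.
Proof.
move=> conn; have [n0|n0] := posnP n; first by rewrite [X in X.-1]n0.
have := graphic_rank_labelling (fun x => conn x (Ordinal n0)).
have -> : #|(fun=> Ordinal n0) @: [set: 'I_n]| = 1.
  apply/eqP/cards1P; exists (Ordinal n0); apply/setP => x; rewrite inE.
  by apply/imsetP/eqP => [[]//|->]; exists (Ordinal n0).
by rewrite addn1 => nr; rewrite (leq_trans _ (graphic_rank_card D)) // -ltnS prednK.
Qed.

Lemma packable_edges E k : packable E k -> k * n.-1 <= #|E|.
Proof.
case=> F [tr disj]; have -> : k * n.-1 = \sum_(i in [set: 'I_k]) n.-1.
  by rewrite sum_nat_const cardsT card_ord.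
apply: leq_trans (sum_card_disjoint (F := F) _ _).
- by apply: leq_sum => i _; case: (tr i) => _ /connected_card.
- by move=> i _; case: (tr i).
- move=> i j e _ _ ei ej; apply/eqP/negPn/negP => /disj.
  by rewrite disjoint_subset => /subsetP/(_ e ei); rewrite inE ej.
Qed.

(** A second vertex forces each tree to use an edge at [v], and these edges are distinct. *)
Lemma packable_deg E k v : 1 < n -> packable E k -> k <= deg E v.
Proof.
move=> n1 [F [tr disj]]; have [w vw] : exists w, v != w.
  have : 0 < #|[set~ v]| by rewrite cardsC1 card_ord; lia.
  by case/card_gt0P => w; rewrite !inE eq_sym; exists w.
have -> : k = \sum_(i in [set: 'I_k]) 1 by rewrite sum_nat_const cardsT card_ord muln1.
pose G i := [set e in F i | v \in e].
apply: leq_trans (sum_card_disjoint (F := G) _ _).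
- apply: leq_sum => i _; case: (tr i) => _ /(_ v w)/connectP[[|z p] /=].
    by move=> _ wv; rewrite wv eqxx in vw.
  move=> /andP[vz _] _ _; apply/card_gt0P; exists [set v; z].
  by rewrite !inE eqxx andbT.
- move=> i _; apply/subsetP => e; rewrite !inE => /andP[eF ->]; rewrite andbT.
  by case: (tr i) => /subsetP ->.
- move=> i j e _ _; rewrite !inE => /andP[ei _] /andP[ej _]; apply/eqP/negPn/negP => /disj.
  by rewrite disjoint_subset => /subsetP/(_ e ei); rewrite inE ej.
Qed.

Lemma edge_other E e u v : E \subset all_edges n -> e \in E -> u \in e -> v \in e ->
  u != v -> e = [set u; v].
Proof.
move=> EA eE ue ve uv; have [x [y [xy eV]]] := edgeP EA eE.
move: ue ve uv; rewrite eV !inE => /orP[] /eqP -> /orP[] /eqP ->; rewrite ?eqxx // => _.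
by rewrite setUC.
Qed.

Lemma edge_neighbor E e u : E \subset all_edges n -> e \in E -> u \in e ->
  exists2 v, v != u & e = [set u; v].
Proof.
move=> EA eE; have [x [y [xy eV]]] := edgeP EA eE; rewrite eV !inE => /orP[] /eqP ->.
  by exists y => //; rewrite eq_sym.
by exists x => //; rewrite setUC.
Qed.

Lemma sum_deg_induced E H : E \subset all_edges n ->
  \sum_(u in H) deg (induced E H) u = 2 * #|induced E H|.
Proof.
move=> EA; rewrite /deg; under eq_bigr do rewrite -sum1dep_card.
rewrite (exchange_big_dep (mem (induced E H))) /=; last by move=> u e _ /andP[].
rewrite mulnC -sum_nat_const; apply: eq_bigr => e; rewrite inE => /andP[eE eH].
rewrite sum1dep_card; have /subsetP/(_ _ eE) := EA; rewrite inE => /eqP <-.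
apply: eq_card => u; rewrite !inE eE eH /=.
by have [/(subsetP eH) ->|] := boolP (u \in e); rewrite ?andbF.
Qed.

(** Low vertices are at distance at least 3. Boolean, so that its failure has an indicator to
    average. *)
Definition separated E y := [forall u, forall v, [==> u != v, deg E u <= y, deg E v <= y =>
  ([set u; v] \notin E) && [forall w, ~~ (([set u; w] \in E) && ([set v; w] \in E))]]].

Lemma separatedP E y u v : separated E y -> u != v -> deg E u <= y -> deg E v <= y ->
  [set u; v] \notin E /\ forall w, ~~ (([set u; w] \in E) && ([set v; w] \in E)).
Proof.
move=> /forallP/(_ u)/forallP/(_ v) /= /implyP H1 /H1/implyP H2 /H2/implyP H3 /H3.
by move=> /andP[-> /forallP].
Qed.

Section Labelling.
Variables (E : {set {set 'I_n}}) (c : 'I_n -> 'I_n).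
Hypothesis EA : E \subset all_edges n.

Let part j := [set x | c x == j].
Let J := c @: setT.
Let cross := [set e in E | [exists x in e, exists y in e, c x != c y]].

(** Summed over the parts, the hypothesis leaves at most the fraction [(n - #|J|) / (n - 1)] of the
    edges inside parts, so at least the fraction [(#|J| - 1) / (n - 1)] crosses. *)
Lemma crossing_edges_small_parts t : t * n.-1 <= #|E| ->
  (forall j, j \in J -> #|induced E (part j)| * n.-1 <= #|E| * #|part j|.-1) ->
  t * #|J|.-1 <= #|cross|.
Proof.
move=> tE small.
have Jn : #|J| <= n by rewrite -[X in (_ <= X)%N]card_ord -cardsT leq_imset_card.
have cover : #|E| <= #|cross| + \sum_(j in J) #|induced E (part j)|.
  rewrite -(cardsID cross E) leq_add ?subset_leq_card ?subsetIr //.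
  rewrite -sum1_card; under [X in _ <= X]eq_bigr do rewrite -sum1_card.
  rewrite (exchange_big_dep (mem E)) /=; last by move=> j e _; rewrite inE => /andP[].
  rewrite [X in _ <= X](bigID (mem (E :\: cross))) /=.
  rewrite [X in _ <= X + _](eq_bigl (mem (E :\: cross))); last first.
    by move=> e; rewrite !inE; case: (e \in E); rewrite ?andbF.
  apply: leq_trans (leq_addr _ _); apply: leq_sum => e.
  rewrite !inE => /andP[+ eE]; rewrite eE /= => /exists_inPn nc.
  have [x [y [_ eV]]] := edgeP EA eE.
  rewrite (bigD1 (c x)) //= !inE eE imset_f //=; apply/subsetP => z ze.
  rewrite inE; have /nc/exists_inPn/(_ z ze) : x \in e by rewrite eV !inE eqxx.
  by rewrite negbK eq_sym.
have parts : \sum_(j in J) #|part j|.-1 + #|J| = n.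
  rewrite -sum1_card -big_split /= -[RHS]card_ord -cardsT -sum1_card.
  rewrite [RHS](partition_big_imset c) /=; apply: eq_bigr => j /imsetP[x _ jx].
  rewrite addn1 prednK; last by apply/card_gt0P; exists x; rewrite inE jx.
  by rewrite -sum1_card; apply: eq_bigl => z; rewrite !inE.
have bound : (\sum_(j in J) #|induced E (part j)|) * n.-1 <= #|E| * (n - #|J|).
  have -> : n - #|J| = \sum_(j in J) #|part j|.-1 by rewrite -[X in X - _]parts addnK.
  rewrite big_distrl big_distrr /=.
  by apply: leq_sum => j jJ; apply: small.
have [n1|n1] := leqP n 1; first by have -> : #|J|.-1 = 0; lia.
set s := \sum_(j in J) #|induced E (part j)| in cover bound.
rewrite -(leq_pmul2r (m := n.-1)); last by lia.
have : (#|cross| + s) * n.-1 >= #|E| * n.-1 by rewrite leq_mul2r cover orbT.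
have [J0|J0] := posnP #|J|; first by rewrite J0 muln0.
have -> : n.-1 = (n - #|J|) + #|J|.-1 by lia.
move: bound tE; have -> : n.-1 = (n - #|J|) + #|J|.-1 by lia.
move: (n - #|J|) (#|J|.-1) => p q; nia.
Qed.

(* Outside the big part, a part made only of low vertices is paid for by the whole star of one of
   its vertices (low vertices are pairwise nonadjacent), and any other part by one of its high
   vertices, of degree > t + 2 g: sparsity costs 2 g edges per high vertex on average, and its
   unique low neighbour costs at most one more. *)
Lemma crossing_edges_big_part t g y j0 : j0 \in J ->
  (forall S, S \subset ~: part j0 -> #|induced E S| <= g * #|S|) ->
  (forall v, t <= deg E v) -> separated E y -> t + 2 * g <= y ->
  t * #|J|.-1 <= #|cross|.
Proof.
move=> j0J sparse tdeg sep tgy.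
pose low := [set v | deg E v <= y].
pose H := [set v | (c v != j0) && (v \notin low)].
pose J' := [set j in J | (j != j0) && (part j \subset low)].
pose rep j := odflt j [pick x | c x == j].
have repP j : j \in J -> c (rep j) = j.
  move=> /imsetP[x _ jx]; rewrite /rep; case: pickP => [z /eqP //|/(_ x)].
  by rewrite jx eqxx.
have lowsep u v : u \in low -> v \in low -> u != v -> [set u; v] \notin E.
  by rewrite !inE => lu lv uv; case: (separatedP sep uv lu lv).
(* Each part other than [j0] contains a high vertex or belongs to [J']. *)
have cJ : #|J|.-1 <= #|H| + #|J'|.
  have := cardsD1 j0 J; rewrite j0J add1n => -> /=.
  apply: leq_trans (leq_add (leq_imset_card c H) (leqnn #|J'|)).
  apply: leq_trans (leq_card_setU _ _); apply/subset_leq_card/subsetP => j.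
  rewrite 2!inE => /andP[jj0 jJ]; rewrite in_setU [j \in J']inE jJ jj0 /=.
  have [//|/subsetPn[x]] := boolP (part j \subset low); first by rewrite orbT.
  rewrite inE => /eqP cx nlow; apply/orP; left; apply/imsetP; exists x => //.
  by rewrite inE cx jj0.
pose nolow := [set e : {set 'I_n} | [disjoint e & low]].
(* Parts in [J'] are paid for by crossing edges with a low end and vertices of [H] by the others, so
   nothing is charged twice. *)
pose X1 := cross :&: nolow.
pose X2 := cross :\: nolow.
have X12 : #|X1| + #|X2| = #|cross| := cardsID nolow cross.
have star2 : t * #|J'| <= #|X2|.
  rewrite mulnC -sum_nat_const.
  pose F j := [set e in E | rep j \in e].
  apply: leq_trans (sum_card_disjoint (F := F) _ _).
  - by apply: leq_sum => j _; apply: tdeg.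
  - move=> j; rewrite inE => /and3P[jJ jj0 /subsetP jlow].
    have rlow : rep j \in low by apply: jlow; rewrite inE repP.
    apply/subsetP => e; rewrite !inE => /andP[eE re].
    have [w wr eV] := edge_neighbor EA eE re.
    rewrite eE /= andbC; apply/andP; split.
      apply/exists_inP; exists (rep j) => //; apply/exists_inP; exists w.
        by rewrite eV !inE eqxx orbT.
      rewrite repP // eq_sym; apply/negP => /eqP cw.
      have wl : w \in low by apply: jlow; rewrite inE cw.
      by have := lowsep _ _ rlow wl; rewrite eq_sym wr -eV eE => /(_ isT).
    by apply/pred0Pn; exists (rep j); rewrite /= re.
  - move=> i j e; rewrite !inE => /and3P[iJ _ /subsetP il] /and3P[jJ _ /subsetP jl].
    move=> /andP[eE re] /andP[_ re'].
    rewrite -(repP i iJ) -(repP j jJ); congr c; apply/eqP/negPn/negP => rr.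
    have := lowsep _ _ (il (rep i) _) (jl (rep j) _) rr.
    by rewrite !inE !repP // !eqxx -(edge_other EA eE re re' rr) eE => /(_ isT isT).
have star1 : t * #|H| <= #|X1|.
  (* Such an edge leaves [H] without meeting a low vertex, so its other end lies in the big part: it
     crosses, and only [u] claims it. *)
  pose F u := [set e in E | [&& u \in e, ~~ (e \subset H) & [disjoint e & low]]].
  apply: leq_trans (sum_card_disjoint (F := F) (P := H) _ _); last 2 first.
  - move=> u; rewrite inE => /andP[cu _]; apply/subsetP => e.
    rewrite !inE => /and4P[eE ue eH elow]; rewrite eE elow andbT /=.
    apply/exists_inP; exists u => //; have [w we wH] := subsetPn eH.
    apply/exists_inP; exists w => //; move: wH; rewrite inE negb_and negbK.
    rewrite (disjointFr elow we) orbF => /eqP ->; exact: cu.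
  - move=> u v e uH vH; rewrite !inE => /and4P[eE ue eH _] /and4P[_ ve _ _].
    apply/eqP/negPn/negP => uv; move: eH; rewrite (edge_other EA eE ue ve uv).
    by rewrite subUset !sub1set uH vH.
  rewrite -(leq_add2r (\sum_(u in H) (deg (induced E H) u + 1))) -big_split /=.
  have HU : H \subset ~: part j0 by apply/subsetP => v; rewrite !inE => /andP[].
  (* By the handshake identity, sparsity bounds the degrees inside [H] by [2 * g] on average, and
     one more unit is reserved for a low neighbour. *)
  apply: leq_trans (_ : \sum_(u in H) (t + 2 * g).+1 <= _).
    rewrite big_split /= sum_deg_induced // !sum_nat_const.
    have := sparse _ HU; rewrite muln1 => sH.
    apply: leq_trans (_ : t * #|H| + (2 * (g * #|H|) + #|H|) <= _); last first.
      by move: #|H| => h; rewrite eq_leq //; ring.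
    by rewrite leq_add2l leq_add2r leq_mul2l sH orbT.
  apply: leq_sum => u uH; have [_ ulow] : c u != j0 /\ u \notin low.
    by move: uH; rewrite inE => /andP[].
  apply: leq_trans (_ : deg E u <= _).
    by move: ulow; rewrite inE -ltnNge; apply: leq_ltn_trans.
  pose B := [set e in E | (u \in e) && ~~ [disjoint e & low]].
  (* Two low neighbours of [u] would have [u] as a common neighbour. *)
  have B1 : #|B| <= 1.
    rewrite leqNgt; apply/negP => /card_gt1P[e [f [+ + ef]]].
    rewrite !inE => /and3P[eE ue /pred0Pn[v /= /andP[ve vl]]].
    move=> /and3P[fE uf /pred0Pn[w /= /andP[wf wl]]].
    have uv : u != v by apply: contraNneq ulow => ->.
    have uw : u != w by apply: contraNneq ulow => ->.
    have eV := edge_other EA eE ue ve uv; have fV := edge_other EA fE uf wf uw.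
    have vw : v != w by apply: contraNneq ef => vw; rewrite eV fV vw.
    move: vl wl; rewrite !inE => vl wl; have [_ /(_ u)] := separatedP sep vw vl wl.
    by rewrite (setUC [set v]) (setUC [set w]) -eV -fV eE fE.
  apply: leq_trans _ (leq_add (leqnn #|F u|) (leq_add (leqnn (deg (induced E H) u)) B1)).
  apply: leq_trans _ (leq_add (leqnn #|F u|) (leq_card_setU _ _)).
  apply: leq_trans _ (leq_card_setU _ _); apply/subset_leq_card/subsetP => e.
  rewrite !inE => /andP[-> ->] /=; rewrite andbT.
  by case: (e \subset H); case: [disjoint e & low].
apply: leq_trans (_ : t * (#|H| + #|J'|) <= _); first by rewrite leq_mul2l cJ orbT.
by rewrite mulnDr -X12 leq_add.
Qed.

End Labelling.

(** [b] separates the two cases of a partition: if some part has more than [n - b] vertices, the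
    others cover fewer than [b]; otherwise the balance condition applies to every part. *)
Lemma packable_of_sparse E t g b y :
  E \subset all_edges n -> t * n.-1 <= #|E| ->
  (forall S, S != set0 -> #|S| + b <= n ->
     #|induced E S| * n.-1 <= #|E| * #|S|.-1) ->
  (forall H, #|H| <= b -> #|induced E H| <= g * #|H|) ->
  (forall v, t <= deg E v) -> separated E y -> t + 2 * g <= y ->
  packable E t.
Proof.
move=> EA tE balanced sparse tdeg sep tgy; apply: nash_williams_tutte => // c.
have [/exists_inP[j0 j0J big]|] :=
    boolP [exists j in c @: setT, n < #|[set x | c x == j]| + b].
  apply: (crossing_edges_big_part EA j0J _ tdeg sep tgy) => S SU; apply: sparse.
  rewrite (leq_trans (subset_leq_card SU)) //.
  by rewrite cardsCs setCK card_ord leq_subLR ltnW.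
move=> /exists_inPn small; apply: crossing_edges_small_parts => // j jJ.
apply: balanced; last by rewrite leqNgt small.
by case/imsetP: jJ => x _ jx; apply/set0Pn; exists x; rewrite inE jx.
Qed.

End Deterministic.

(** * Reduction of the event to a packing of the required size *)

Lemma bigmin_leq (I : eqType) (r : seq I) (F : I -> nat) (m : nat) (v : I) :
  v \in r -> \big[minn/m]_(i <- r) F i <= F v.
Proof.
elim: r => // x r IH; rewrite inE big_cons geq_min => /orP[/eqP ->|/IH ->].
  by rewrite leqnn.
by rewrite orbT.
Qed.

Lemma card_all_edges (n : nat) : #|all_edges n| = 'C(n, 2).
Proof. by rewrite card_draws card_ord. Qed.

Lemma mindeg_leq (n : nat) (E : {set {set 'I_n}}) v : mindeg E <= deg E v.
Proof. exact/bigmin_leq/mem_index_enum. Qed.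

Lemma stp_event_of_packable (n : nat) (E : {set {set 'I_n}}) :
  1 < n -> E \subset all_edges n ->
  packable E (minn (mindeg E) (nedges E %/ n.-1)) -> stp_event E.
Proof.
move=> n1 EA pk; rewrite /stp_event /stp; set t := minn _ _ in pk *.
have n0 : 0 < n.-1 by lia.
have tE : t < #|E|.+1 by rewrite ltnS (leq_trans (geq_minr _ _)) // leq_div.
apply/eqP; rewrite eqn_leq; apply/andP; split; last first.
  by apply: (@leq_bigmax_cond _ _ (fun i : 'I_#|E|.+1 => i : nat) (Ordinal tE)); apply/asboolP.
apply/bigmax_leqP => k /asboolP pk'; rewrite leq_min leq_divRL // packable_edges // andbT.
rewrite /mindeg; elim/big_ind: _ => [|x y|v _]; last exact: packable_deg.
  (* The default value [n] of the minimum also has to be at least [k]; this follows from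
     [k * n.-1 <= 'C(n, 2)]. *)
  have := leq_trans (packable_edges pk') (subset_leq_card EA).
  rewrite card_all_edges bin2 => h; have : k * n.-1 <= n * n.-1.
    by apply: leq_trans h _; move: (n * n.-1) => x; lia.
  by rewrite leq_pmul2r.
by rewrite leq_min => -> ->.
Qed.

Lemma packable0 (n : nat) (E : {set {set 'I_n}}) : packable E 0.
Proof. by exists (fun=> set0); split=> -[]. Qed.

Local Open Scope ring_scope.

(** * Random subsets and binomial tails *)

Section RandomSubset.
Variables (R : realFieldType) (p : R).

(** Expectation over a random subset of [A] that keeps each element independently with probability
    [p]; probabilities are expectations of 0/1 indicators. *)
Definition Ex (T : finType) (A : {set T}) (f : {set T} -> R) : R :=
  \sum_(E in powerset A) p ^+ #|E| * (1 - p) ^+ (#|A| - #|E|) * f E.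

(** Expectation of [phi] at a binomial variable, by conditioning on one trial, so that tail bounds
    go by induction on [N]. *)
Fixpoint binE (N : nat) (phi : nat -> R) : R :=
  if N is N'.+1 then p * binE N' (fun j => phi j.+1) + (1 - p) * binE N' phi
  else phi 0%N.

Definition bincdf (N x : nat) : R := binE N (fun j => (j <= x)%N%:R).

Section Expectation.
Variable T : finType.
Implicit Types (A B E X Y : {set T}) (f g : {set T} -> R).

Lemma eq_Ex A f g : (forall E, E \subset A -> f E = g E) -> Ex A f = Ex A g.
Proof. by move=> fg; apply: eq_bigr => E; rewrite powersetE => /fg ->. Qed.

Lemma ExD A f g : Ex A (fun E => f E + g E) = Ex A f + Ex A g.
Proof. by rewrite -big_split; apply: eq_bigr => E _; rewrite /= mulrDr. Qed.

Lemma ExZ A k f : Ex A (fun E => k * f E) = k * Ex A f.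
Proof. by rewrite big_distrr; apply: eq_bigr => E _; rewrite /= mulrCA. Qed.

Lemma Ex_sum (I : finType) (P : pred I) A (f : I -> {set T} -> R) :
  Ex A (fun E => \sum_(i | P i) f i E) = \sum_(i | P i) Ex A (f i).
Proof. by rewrite exchange_big; apply: eq_bigr => E _; rewrite /= big_distrr. Qed.

(** Fubini for the product measure: the source of all independence statements below. *)
Lemma Ex_setU A B f : [disjoint A & B] ->
  Ex (A :|: B) f = Ex A (fun X => Ex B (fun Y => f (X :|: Y))).
Proof.
move=> dAB; rewrite /Ex.
under [RHS]eq_bigr do rewrite big_distrr /=.
rewrite pair_big /= (reindex_onto (fun XY : {set T} * {set T} => XY.1 :|: XY.2)
   (fun E => (E :&: A, E :&: B))) /=; last first.
  by move=> E; rewrite powersetE -setIUr => /setIidPl.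
have AB0 : A :&: B = set0 by apply/eqP; rewrite setI_eq0.
apply: eq_big => [[X Y]|[X Y] /andP[_ /eqP[XA YB]]] /=.
  rewrite !powersetE xpair_eqE; apply/andP/andP => [[_ /andP[/eqP <- /eqP <-]]|[XA YB]].
    by rewrite !subsetIr.
  rewrite subUset !subsetU ?XA ?YB ?orbT //; split=> //.
  rewrite !setIUl (setIidPl XA) (setIidPl YB).
  have -> : Y :&: A = set0.
    by apply/eqP; rewrite -subset0 -AB0 setIC setIS.
  have -> : X :&: B = set0 by apply/eqP; rewrite -subset0 -AB0 setSI.
  by rewrite setU0 set0U !eqxx.
have XsA : X \subset A by rewrite -XA subsetIr.
have YsB : Y \subset B by rewrite -YB subsetIr.
have XY0 : #|X :&: Y| = 0%N.
  by apply/eqP; rewrite cards_eq0 -subset0 -AB0 setISS.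
rewrite !cardsU XY0 AB0 cards0 !subn0.
have := subset_leq_card XsA; have := subset_leq_card YsB => hY hX.
have -> : (#|A| + #|B| - (#|X| + #|Y|) = (#|A| - #|X|) + (#|B| - #|Y|))%N by lia.
by rewrite !exprD; ring.
Qed.

Lemma Ex0 f : Ex set0 f = f set0.
Proof. by rewrite /Ex powerset0 big_set1 !cards0 !expr0 !mul1r. Qed.

Lemma Ex1 x f : Ex [set x] f = p * f [set x] + (1 - p) * f set0.
Proof.
have s0 : set0 != [set x] by apply/eqP => /setP/(_ x); rewrite !inE eqxx.
rewrite /Ex (bigD1 [set x]) ?powersetE //= (bigD1 set0) /=; last first.
  by rewrite powersetE sub0set s0.
rewrite big1 ?addr0 => [|E /andP[/andP[]]]; last first.
  by rewrite powersetE subset1 => /orP[] /eqP ->; rewrite eqxx.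
by rewrite !cards1 !cards0 expr1 expr0 mul1r mulr1.
Qed.

Lemma ExU1 x A f : x \notin A ->
  Ex (x |: A) f = p * Ex A (fun E => f (x |: E)) + (1 - p) * Ex A f.
Proof.
move=> xA; rewrite Ex_setU ?disjoints1 // Ex1; congr (_ + _ * _).
by apply: eq_Ex => E _; rewrite set0U.
Qed.

Lemma set_card_ind (P : {set T} -> Prop) :
  P set0 -> (forall x A, x \notin A -> P A -> P (x |: A)) -> forall A, P A.
Proof.
move=> P0 PU A; have [k] := ubnP #|A|; elim: k A => // k IH A Ak.
have [->//|[x xA]] := set_0Vmem A.
rewrite -(setD1K xA); apply: PU; first by rewrite !inE eqxx.
by apply: IH; have := cardsD1 x A; rewrite xA; lia.
Qed.

Lemma Ex_const A k : Ex A (fun=> k) = k.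
Proof.
elim/set_card_ind: A => [|x A xA IH]; first by rewrite Ex0.
by rewrite ExU1 // IH; ring.
Qed.

Lemma Ex_card A phi : Ex A (fun E => phi #|E|) = binE #|A| phi.
Proof.
elim/set_card_ind: A phi => [|x A xA IH] phi; first by rewrite Ex0 !cards0.
rewrite ExU1 // cardsU1 xA /= -!IH; congr (_ * _ + _).
apply: eq_Ex => E EA; rewrite cardsU1.
by rewrite (contra (subsetP EA x) xA).
Qed.

Lemma Ex_subset A : Ex A (fun E => (A \subset E)%:R) = p ^+ #|A|.
Proof.
elim/set_card_ind: A => [|x A xA IH]; first by rewrite Ex0 subxx cards0.
rewrite ExU1 // cardsU1 xA exprS -IH [X in _ + _ * X](_ : _ = 0) ?mulr0 ?addr0.
  congr (_ * _); apply: eq_Ex => E EA; congr (_%:R); congr nat_of_bool.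
  apply/idP/idP => [/subsetP H|]; last exact: setUS.
  apply/subsetP => y yA; have := H y; rewrite !inE yA orbT => /(_ isT)/orP[/eqP yx|//].
  by rewrite yx (negPf xA) in yA.
rewrite -[RHS](Ex_const A); apply: eq_Ex => E EA.
by rewrite subUset sub1set (negPf (contra (subsetP EA x) xA)).
Qed.

Lemma Ex_restrict A B f : A \subset B -> Ex B (fun E => f (E :&: A)) = Ex A f.
Proof.
move=> AB; rewrite -(setID B A) (setIidPr AB).
have d : [disjoint A & B :\: A] by rewrite disjoint_sym disjoints_subset setDE subsetIr.
rewrite Ex_setU //; apply: eq_Ex => X XA.
rewrite -[RHS](Ex_const (B :\: A)); apply: eq_Ex => Y YA; congr f.
rewrite setIUl (setIidPl XA) (_ : Y :&: A = set0) ?setU0 //; apply/eqP.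
by rewrite setI_eq0 disjoint_sym (disjointWr YA).
Qed.

Lemma Ex_indep A B f g : [disjoint A & B] ->
  Ex (A :|: B) (fun E => f (E :&: A) * g (E :&: B)) = Ex A f * Ex B g.
Proof.
move=> dAB; rewrite Ex_setU // mulrC -ExZ; apply: eq_Ex => X XA.
rewrite mulrC -ExZ; apply: eq_Ex => Y YB.
have dXB : X :&: B = set0 by apply/eqP; rewrite setI_eq0 (disjointWl XA).
have dYA : Y :&: A = set0 by apply/eqP; rewrite setI_eq0 disjoint_sym (disjointWr YB).
by rewrite !setIUl (setIidPl XA) (setIidPl YB) dXB dYA setU0 set0U.
Qed.

Lemma Ex_indep3 (S A B C : {set T}) f phi psi :
  A :|: (B :|: C) \subset S -> [disjoint A & B :|: C] -> [disjoint B & C] ->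
  Ex S (fun E => f (E :&: A) * (phi #|E :&: B| * psi #|E :&: C|)) =
  Ex A f * (binE #|B| phi * binE #|C| psi).
Proof.
move=> sub dA dBC; rewrite -!Ex_card -Ex_indep // -Ex_indep // -(Ex_restrict _ sub).
apply: eq_Ex => E _; rewrite -!setIA.
have sB := subsetUl B C; have sC := subsetUr B C; have sBC := subsetUr A (B :|: C).
rewrite !(setIidPr sB) !(setIidPr sC) !(setIidPr (subsetUl A _)).
by rewrite !(setIidPr (subset_trans _ sBC)).
Qed.

Hypothesis p01 : 0 <= p <= 1.

Lemma le_Ex A f g : (forall E, E \subset A -> f E <= g E) -> Ex A f <= Ex A g.
Proof.
have [p0 p1] := andP p01.
move=> fg; apply: ler_sum => E; rewrite powersetE => EA.
by rewrite ler_wpM2l ?fg // mulr_ge0 // exprn_ge0 // subr_ge0.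
Qed.

Lemma Ex_ge0 A f : (forall E, E \subset A -> 0 <= f E) -> 0 <= Ex A f.
Proof. by move=> f0; rewrite -(Ex_const A 0); apply: le_Ex. Qed.

End Expectation.

Lemma eq_binE N phi psi : phi =1 psi -> binE N phi = binE N psi.
Proof.
elim: N phi psi => [|N IH] phi psi e /=; first exact: e.
by rewrite (IH _ _ e) (IH _ (fun j => psi j.+1)) // => j; apply: e.
Qed.

Lemma binE_scale N k phi : binE N (fun j => k * phi j) = k * binE N phi.
Proof. by elim: N phi => //= N IH phi; rewrite !IH; ring. Qed.

Lemma binE_geometric N a : binE N (fun j => a ^+ j) = (1 - p + p * a) ^+ N.
Proof.
elim: N => //= N IH; under eq_binE do rewrite exprS.
by rewrite binE_scale IH exprS; ring.
Qed.

Hypothesis p01 : 0 <= p <= 1.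

Lemma le_binE N phi psi : (forall j, phi j <= psi j) -> binE N phi <= binE N psi.
Proof.
have [p0 p1] := andP p01; elim: N phi psi => [|N IH] phi psi e //=.
by apply: lerD; apply: ler_wpM2l; rewrite ?subr_ge0 //; apply: IH.
Qed.

Lemma bincdf_ge0 N x : 0 <= bincdf N x.
Proof.
apply: (@le_trans _ _ (binE N (fun j => 0 * 1))); last first.
  by apply: le_binE => j; rewrite mul0r ler0n.
by rewrite binE_scale mul0r.
Qed.

Lemma bincdf_S N x : bincdf N.+1 x.+1 = p * bincdf N x + (1 - p) * bincdf N x.+1.
Proof. by []. Qed.

Lemma bincdf_S0 N : bincdf N.+1 0 = (1 - p) * bincdf N 0.
Proof.
rewrite {1}/bincdf /= (_ : binE N _ = 0) ?mulr0 ?add0r //.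
by rewrite (@eq_binE _ _ (fun=> 0 * 1)) ?binE_scale ?mul0r // => j; rewrite ltn0 mul0r.
Qed.

Lemma bincdf0 N : bincdf N 0 = (1 - p) ^+ N.
Proof. by elim: N => // N IH; rewrite bincdf_S0 IH exprS. Qed.

Lemma le_bincdf N x y : (x <= y)%N -> bincdf N x <= bincdf N y.
Proof. by move=> xy; apply: le_binE => j; rewrite ler_nat; case: (leqP j x) => // /leq_trans ->. Qed.

Lemma bincdf_leS N x : bincdf N.+1 x <= bincdf N x.
Proof.
have [p0 p1] := andP p01; case: x => [|x].
  by rewrite bincdf_S0 -[leRHS]mul1r ler_wpM2r ?bincdf_ge0 // gerBl.
rewrite bincdf_S; have := le_bincdf N (leqnSn x); nra.
Qed.

Lemma bincdf_leSS N x : bincdf N x <= bincdf N.+1 x.+1.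
Proof.
have [p0 p1] := andP p01; rewrite bincdf_S; have := le_bincdf N (leqnSn x); nra.
Qed.

Lemma bincdf_full N x : (N <= x)%N -> bincdf N x = 1.
Proof.
elim: N x => // N IH [|x] // Nx; rewrite bincdf_S !IH //; last exact: ltnW.
ring.
Qed.

(* A set of at most x + h successes is one of at most x successes together with one of i <= h,
   whose relative weight is (p / (1 - p))^i; the second factor bounds the sum over i <= h of
   C(N, i) (p / (1 - p))^i. *)
Lemma bincdf_shift N x h a : p < 1 -> 0 < a <= 1 ->
  bincdf N (x + h) <= bincdf N x * (a^-1 ^+ h * (1 + a * (p / (1 - p))) ^+ N).
Proof.
have [p0 _] := andP p01 => p1 /andP[a0 a1]; set r := p / (1 - p).
have q0 : 0 < 1 - p by rewrite subr_gt0.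
have r0 : 0 <= r by rewrite divr_ge0 // ltW.
have ar0 : 0 <= a * r by rewrite mulr_ge0 // ltW.
have ai1 : 1 <= a^-1 by rewrite invf_ge1.
elim: N x h => [|N IH] x h.
  by rewrite /bincdf /= mul1r expr0 mulr1 exprn_ege1.
set B := (1 + a * r) ^+ N in IH; have B0 : 0 <= B by rewrite exprn_ge0 // addr_ge0.
rewrite exprS -/B.
have IHx := IH x h; have c0 := bincdf_ge0 N x; have e0 : 0 <= a^-1 ^+ h.
  by rewrite exprn_ge0 // invr_ge0 ltW.
set G := a^-1 ^+ h * B in IHx; have G0 : 0 <= G by rewrite mulr_ge0.
have -> : a^-1 ^+ h * ((1 + a * r) * B) = G * (1 + a * r) by rewrite /G; ring.
have qr : (1 - p) * r = p by rewrite /r mulrC divfK // gt_eqF.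
case: x IHx c0 => [|x] IHx c0.
  rewrite add0n in IHx *; rewrite bincdf_S0.
  have [h0|h0] := posnP h.
    rewrite [in bincdf _ h]h0 bincdf_S0 -mulrA ler_wpM2l ?(ltW q0) //.
    rewrite [in bincdf _ h]h0 in IHx.
    by rewrite (le_trans IHx) // ler_wpM2l // ler_peMr // lerDl.
  (* When [x = 0] a success must lower [h] instead of [x]; this gains a factor [a], and
     [(1 - p) * r = p] matches the extra term [a * r]. *)
  have := IH 0%N h.-1; rewrite add0n.
  have -> : a^-1 ^+ h.-1 * B = a * G.
    by rewrite /G -[in RHS](prednK h0) exprS !mulrA divff ?mul1r // gt_eqF.
  move=> IHh; rewrite -[in bincdf _ h](prednK h0) bincdf_S (prednK h0).
  have -> : (1 - p) * bincdf N 0 * (G * (1 + a * r)) =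
     p * (bincdf N 0 * (a * G)) + (1 - p) * (bincdf N 0 * G).
    by rewrite -[X in X * (_ * _) + _]qr; ring.
  by rewrite lerD // ler_wpM2l // ltW.
rewrite addSn !bincdf_S [leRHS]mulrDl lerD // -mulrA ler_wpM2l ?(ltW q0) //.
  rewrite (le_trans (IH x h)) // -/G ler_wpM2l ?bincdf_ge0 // ler_peMr // lerDl //.
rewrite -addSn (le_trans IHx) // ler_wpM2l // ler_peMr // lerDl //.
Qed.

End RandomSubset.

(** * Low-degree vertices of the random graph *)

Section RandomGraph.
Variables (R : realFieldType) (p : R) (n : nat).
Hypothesis p01 : 0 <= p <= 1.
Implicit Types (E B C : {set {set 'I_n}}) (u v w : 'I_n) (S : {set 'I_n}).

Let A := all_edges n.

Definition star v := [set e in A | v \in e].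

Lemma star_all_edges v : star v \subset A.
Proof. by apply/subsetP => e; rewrite inE => /andP[]. Qed.

Lemma pair_in_all_edges u v : ([set u; v] \in A) = (u != v).
Proof. by rewrite inE cards2; case: (u != v). Qed.

Lemma deg_star E v : E \subset A -> deg E v = #|E :&: star v|.
Proof.
move=> EA; apply: eq_card => e; rewrite [in RHS]inE [e \in star v]inE inE.
by case eE: (e \in E) => //=; rewrite (subsetP EA e eE).
Qed.

Lemma card_star v : #|star v| = n.-1.
Proof.
have -> : star v = (fun w => [set v; w]) @: [set~ v].
  apply/setP => e; apply/idP/imsetP => [|[w + ->]].
    rewrite inE => /andP[eA ve]; have [w wv ->] := edge_neighbor (subxx A) eA ve.
    by exists w => //; rewrite !inE.
  by rewrite !inE cards2 eqxx eq_sym => ->.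
rewrite card_in_imset ?cardsC1 ?card_ord // => w z.
rewrite !inE => wv zv /setP/(_ w); rewrite !inE eqxx orbT (negPf wv) /=.
by move=> /esym/eqP.
Qed.

Lemma Ex_deg v phi : Ex p A (fun E => phi (deg E v)) = binE p n.-1 phi.
Proof.
rewrite -(card_star v) -Ex_card -(Ex_restrict _ _ (star_all_edges v)).
by apply: eq_Ex => E EA; rewrite deg_star.
Qed.

Lemma Ex_induced S phi :
  Ex p A (fun E => phi #|induced E S|) = binE p 'C(#|S|, 2) phi.
Proof.
rewrite -cards_draws -Ex_card.
rewrite -(@Ex_restrict _ _ _ [set e : {set 'I_n} | e \subset S & #|e| == 2] A).
  apply: eq_Ex => E EA; congr phi; apply: eq_card => e; rewrite !inE.
  case eE: (e \in E) => //=; have := subsetP EA e eE; rewrite inE => ->.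
  by rewrite andbT.
by apply/subsetP => e; rewrite !inE => /andP[].
Qed.

Lemma star_disjoint u v : u != v ->
  [disjoint star u :\ [set u; v] & star v :\ [set u; v]].
Proof.
move=> uv; apply/pred0P => e /=; rewrite !inE; apply/negP.
move=> /andP[/and3P[ne eA ue] /and3P[_ _ ve]].
have eA' : e \in A by rewrite inE.
by move: ne; rewrite (edge_other (subxx A) eA' ue ve uv) eqxx.
Qed.

Lemma deg_star_pair E u v : u != v -> E \subset A ->
  deg E u = (([set u; v] \in E) + #|E :&: (star u :\ [set u; v])|)%N.
Proof.
move=> uv EA; rewrite deg_star // (cardsD1 [set u; v] (E :&: star u)).
rewrite !inE cards2 uv eqxx /= andbT; congr (_ + _)%N; apply: eq_card => e.
by rewrite !inE; case: (e \in E); rewrite /= ?andbF.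
Qed.

Lemma card_star_pair u v : u != v -> #|star u :\ [set u; v]| = n.-2.
Proof.
move=> uv; have := cardsD1 [set u; v] (star u).
by rewrite card_star !inE cards2 uv eqxx /= add1n => /(congr1 predn) /= <-.
Qed.

(** Given the status of the edge [uv], the two degrees depend on disjoint stars; a present edge
    already uses one unit, whence [j < y]. *)
Lemma Ex_low_pair u v y : u != v ->
  Ex p A (fun E => ((deg E u <= y) && (deg E v <= y))%N%:R) =
  p * binE p n.-2 (fun j => (j < y)%N%:R) ^+ 2 + (1 - p) * bincdf p n.-2 y ^+ 2.
Proof.
move=> uv; have vu : v != u by rewrite eq_sym.
set D := [set [set u; v]]; set U := star u :\ [set u; v]; set V := star v :\ [set u; v].
have sub : D :|: (U :|: V) \subset A.
  rewrite !subUset sub1set pair_in_all_edges uv /= /U /V.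
  by rewrite !(subset_trans (subsetDl _ _) (star_all_edges _)).
have dD : [disjoint D & U :|: V] by rewrite disjoints1 !inE eqxx.
have dUV := star_disjoint uv.
have cU : #|U| = n.-2 := card_star_pair uv.
have cV : #|V| = n.-2 by rewrite /V setUC card_star_pair.
pose f b (X : {set {set 'I_n}}) : R := (([set u; v] \in X) == b)%:R.
pose low d j : R := (j + d <= y)%N%:R.
transitivity (Ex p A (fun E => f true (E :&: D) * (low 1 #|E :&: U| * low 1 #|E :&: V|) +
  f false (E :&: D) * (low 0 #|E :&: U| * low 0 #|E :&: V|))).
  apply: eq_Ex => E EA; rewrite (deg_star_pair uv EA) (deg_star_pair vu EA).
  rewrite (setUC [set v]) -/U -/V /f /low in_setI set11 andbT.
  case: ([set u; v] \in E) => /=; rewrite ?addn1 ?addn0 ?add1n ?add0n !(mul1r, mul0r);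
    rewrite ?addr0 ?add0r -natrM mulnb //.
rewrite ExD !(Ex_indep3 _ _ _ _ sub dD dUV) cU cV /f !Ex1 set11 in_set0 /=.
rewrite !mulr1 !mulr0 addr0 add0r -!expr2; congr (_ * _ ^+ 2 + _ * _ ^+ 2).
  by apply: eq_binE => j; rewrite /low addn1.
by apply: eq_binE => j; rewrite /low addn0.
Qed.

Lemma bincdf_anti m k y : (m <= k)%N -> bincdf p k y <= bincdf p m y.
Proof.
move=> /subnK <-; elim: (k - m)%N => [|d IH]; first by rewrite add0n.
by rewrite addSn (le_trans _ IH) // bincdf_leS.
Qed.

(** Expose the edges of [B] and require those of [C]. As [B] contains [uv], what is left of the two
    stars is disjoint, and each keeps at least [n - 3] edges. *)
Lemma Ex_low_pair_subset u v y B C : u != v -> B \subset A -> C \subset B ->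
  [set u; v] \in B -> (#|B :&: star u| <= 2)%N -> (#|B :&: star v| <= 2)%N ->
  Ex p A (fun E => [&& C \subset E, deg E u <= y & deg E v <= y]%N%:R) <=
  p ^+ #|C| * bincdf p (n - 3) y ^+ 2.
Proof.
move=> uv BA CB uvB Bu Bv.
set U := star u :\: B; set V := star v :\: B.
have sub : B :|: (U :|: V) \subset A.
  by rewrite !subUset BA /U /V !(subset_trans (subsetDl _ _) (star_all_edges _)).
have dB : [disjoint B & U :|: V].
  by rewrite disjoint_sym disjoints_subset subUset /U /V !setDE !subsetIr.
have dUV : [disjoint U & V].
  have uvB' : [set [set u; v]] \subset B by rewrite sub1set.
  apply: disjointWl (setDS _ uvB') _; apply: disjointWr (setDS _ uvB') _.
  exact: star_disjoint.
have cU : (n - 3 <= #|U|)%N by rewrite cardsD card_star setIC -subn1 -subnDA leq_sub2l.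
have cV : (n - 3 <= #|V|)%N by rewrite cardsD card_star setIC -subn1 -subnDA leq_sub2l.
pose f (X : {set {set 'I_n}}) : R := (C \subset X)%:R.
pose low j : R := (j <= y)%N%:R.
apply: (@le_trans _ _ (Ex p A (fun E => f (E :&: B) * (low #|E :&: U| * low #|E :&: V|)))).
  apply: le_Ex => // E EA; rewrite /f /low subsetI CB andbT.
  rewrite !deg_star // -!natrM !mulnb ler_nat.
  have lU : (#|E :&: U| <= #|E :&: star u|)%N by rewrite subset_leq_card // setIS // subsetDl.
  have lV : (#|E :&: V| <= #|E :&: star v|)%N by rewrite subset_leq_card // setIS // subsetDl.
  case: (C \subset E) => //=; case: (leqP #|_ :&: star u| y) => //= hu.
  case: (leqP #|_ :&: star v| y) => //= hv.
  by rewrite (leq_trans lU hu) (leq_trans lV hv).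
rewrite (Ex_indep3 _ _ _ _ sub dB dUV).
have -> : Ex p B f = p ^+ #|C|.
  rewrite -Ex_subset -(Ex_restrict _ _ CB); apply: eq_Ex => E _.
  by rewrite /f subsetI subxx andbT.
have [p0 _] := andP p01.
rewrite expr2 ler_wpM2l ?exprn_ge0 // ler_pM ?bincdf_ge0 //; exact: bincdf_anti.
Qed.

Lemma Ex_low_adjacent u v y : u != v ->
  Ex p A (fun E => [&& [set u; v] \in E, deg E u <= y & deg E v <= y]%N%:R) <=
  p * bincdf p (n - 3) y ^+ 2.
Proof.
move=> uv; have := @Ex_low_pair_subset u v y [set [set u; v]] [set [set u; v]] uv.
rewrite sub1set pair_in_all_edges uv subxx set11 cards1 expr1.
have H X : (#|[set [set u; v]] :&: X| <= 2)%N.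
  by rewrite (leq_trans (subset_leq_card (subsetIl _ _))) // cards1.
move=> /(_ isT isT isT (H _) (H _)); apply: le_trans.
by apply: le_Ex => // E _; rewrite sub1set.
Qed.

Lemma Ex_low_common u v w y : u != v -> w != u -> w != v ->
  Ex p A (fun E => [&& [set u; w] \in E, [set v; w] \in E, deg E u <= y
     & deg E v <= y]%N%:R) <= p ^+ 2 * bincdf p (n - 3) y ^+ 2.
Proof.
move=> uv wu wv; set C := [set [set u; w]; [set v; w]].
have uwvw : [set u; w] != [set v; w].
  apply/eqP => /setP/(_ u); rewrite !inE eqxx /=.
  by rewrite (negPf uv) eq_sym (negPf wu).
have cC : #|C| = 2%N by rewrite cards2 uwvw.
have := @Ex_low_pair_subset u v y ([set u; v] |: C) C uv.
rewrite subUset sub1set pair_in_all_edges uv subUset !sub1set !pair_in_all_edges.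
rewrite [u == w]eq_sym [v == w]eq_sym wu wv subsetUr setU11 cC => /(_ isT isT isT).
have Hu : (#|([set u; v] |: C) :&: star u| <= 2)%N.
  apply: (@leq_trans #|[set [set u; v]; [set u; w]]|); last by rewrite cards2; case: (_ != _).
  apply/subset_leq_card/subsetP => e; rewrite in_setI !in_setU !in_set1.
  move=> /andP[/or3P[] /eqP -> ]; rewrite ?eqxx ?orbT // !inE.
  by rewrite (negPf uv) [u == w]eq_sym (negPf wu) andbF.
have Hv : (#|([set u; v] |: C) :&: star v| <= 2)%N.
  apply: (@leq_trans #|[set [set u; v]; [set v; w]]|); last by rewrite cards2; case: (_ != _).
  apply/subset_leq_card/subsetP => e; rewrite in_setI !in_setU !in_set1.
  move=> /andP[/or3P[] /eqP -> ]; rewrite ?eqxx ?orbT // !inE.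
  by rewrite [v == u]eq_sym (negPf uv) [v == w]eq_sym (negPf wv) andbF.
move=> /(_ Hu Hv); apply: le_trans; apply: le_Ex => // E _.
by rewrite subUset !sub1set andbA.
Qed.

(** Union bound over adjacent pairs and over pairs with a common neighbour. *)
Lemma Ex_not_separated y :
  Ex p A (fun E => (~~ separated E y)%:R) <=
  (n%:R ^+ 2 * p + n%:R ^+ 3 * p ^+ 2) * bincdf p (n - 3) y ^+ 2.
Proof.
have [p0 _] := andP p01; set F2 := bincdf _ _ _ ^+ 2.
have F20 : 0 <= F2 by apply: sqr_ge0.
pose I1 u v E : R := [&& [set u; v] \in E, deg E u <= y & deg E v <= y]%N%:R.
pose I2 u v w E : R := [&& [set u; w] \in E, [set v; w] \in E, deg E u <= y
     & deg E v <= y]%N%:R.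
apply: (@le_trans _ _ (Ex p A (fun E => \sum_u \sum_(v | u != v)
   (I1 u v E + \sum_(w | (w != u) && (w != v)) I2 u v w E)))).
  apply: le_Ex => // E EA.
  have I1_ge0 u v : 0 <= I1 u v E by rewrite ler0n.
  have I2_ge0 u v w : 0 <= I2 u v w E by rewrite ler0n.
  have I_ge0 u v : 0 <= I1 u v E + \sum_(w | (w != u) && (w != v)) I2 u v w E.
    by rewrite addr_ge0 // sumr_ge0.
  have [|ns] := boolP (separated E y); first by rewrite sumr_ge0 // => u _; rewrite sumr_ge0.
  move: ns; rewrite negb_forall => /existsP[u]; rewrite negb_forall => /existsP[v].
  rewrite !negb_imply => /and4P[uv lu lv].
  rewrite negb_and negbK negb_forall => bad.
  rewrite (bigD1 u) //= (bigD1 v) //= -addrA ler_wpDr //.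
    by rewrite addr_ge0 ?sumr_ge0 // => u' _; rewrite sumr_ge0.
  case/orP: bad => [uvE|/existsP[w]]; first by rewrite ler_wpDr ?sumr_ge0 // /I1 uvE lu lv.
  rewrite negbK => /andP[uw vw].
  have wu : w != u by have := subsetP EA _ uw; rewrite pair_in_all_edges eq_sym.
  have wv : w != v by have := subsetP EA _ vw; rewrite pair_in_all_edges eq_sym.
  rewrite ler_wpDl // (bigD1 w) /= ?wu ?wv // ler_wpDr ?sumr_ge0 //.
  by rewrite /I2 uw vw lu lv.
rewrite Ex_sum; under eq_bigr do rewrite Ex_sum.
have sum_bound (P : pred 'I_n) (c : R) : 0 <= c -> \sum_(i | P i) c <= n%:R * c.
  move=> c0; rewrite big_const iter_addr_0 -[c *+ _]mulr_natl ler_wpM2r // ler_nat.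
  by rewrite -[X in (_ <= X)%N]card_ord max_card.
apply: (@le_trans _ _ (\sum_(u : 'I_n) \sum_(v | u != v) (p * F2 + n%:R * (p ^+ 2 * F2)))).
  apply: ler_sum => u _; apply: ler_sum => v uv; rewrite ExD Ex_sum lerD //.
    exact: Ex_low_adjacent.
  have c2 : 0 <= p ^+ 2 * F2 by rewrite mulr_ge0 // exprn_ge0.
  apply: le_trans (sum_bound _ _ c2).
  by apply: ler_sum => w /andP[wu wv]; apply: Ex_low_common.
have c0 : 0 <= p * F2 + n%:R * (p ^+ 2 * F2).
  by rewrite addr_ge0 // mulr_ge0 // mulr_ge0 // exprn_ge0.
apply: (@le_trans _ _ (\sum_(u : 'I_n) n%:R * (p * F2 + n%:R * (p ^+ 2 * F2)))).
  by apply: ler_sum => u _; apply: sum_bound.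
rewrite (le_trans (sum_bound _ _ _)) ?mulr_ge0 //; lra.
Qed.

(* Chebyshev's inequality for the number of vertices of degree at most x, whose mean is M. *)
Lemma Ex_mindeg_gt x M : (1 < n)%N -> M = n%:R * bincdf p n.-1 x ->
  (1 - p) * (Ex p A (fun E => [forall v, x < deg E v]%N%:R) * M ^+ 2) <=
  (1 - p) * M + p * M ^+ 2.
Proof.
move=> n1 ME; have [p0 p1] := andP p01.
pose low v E : R := (deg E v <= x)%N%:R.
pose X E : R := \sum_v low v E.
have EX : Ex p A X = M.
  rewrite Ex_sum (eq_bigr (fun=> bincdf p n.-1 x)) => [|v _]; last first.
    by rewrite (Ex_deg v (fun j => (j <= x)%N%:R)).
  by rewrite big_const iter_addr_0 card_ord ME -[LHS]mulr_natl.
set F := bincdf p n.-2 x; set f := binE p n.-2 (fun j => (j < x)%N%:R).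
have QE : bincdf p n.-1 x = p * f + (1 - p) * F.
  have -> : n.-1 = n.-2.+1 by lia.
  by [].
have f0 : 0 <= f.
  apply: (@le_trans _ _ (binE p n.-2 (fun j => 0 * 1))); first by rewrite binE_scale mul0r.
  by apply: le_binE => // j; rewrite mul0r ler0n.
have fF : f <= F by apply: le_binE => // j; rewrite ler_nat; case: ltngtP.
set P2 := p * f ^+ 2 + (1 - p) * F ^+ 2.
(* Two vertices are correlated only through their common edge, at the price of a factor
   [1 / (1 - p)], kept multiplied out because [p = 1] is allowed. *)
have P2_bound : (1 - p) * P2 <= bincdf p n.-1 x ^+ 2.
  rewrite QE /P2; have : 0 <= p * (1 - p) * f * (2 * F - f) + p ^+ 2 * f ^+ 2.
    by rewrite addr_ge0 ?mulr_ge0 ?sqr_ge0 //; lra.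
  lra.
have P20 : 0 <= P2 by rewrite /P2 addr_ge0 // mulr_ge0 ?sqr_ge0 //; lra.
have EX2 : Ex p A (fun E => X E ^+ 2) <= M + n%:R ^+ 2 * P2.
  have -> : Ex p A (fun E => X E ^+ 2) =
      \sum_u \sum_v Ex p A (fun E => low u E * low v E).
    transitivity (Ex p A (fun E => \sum_u \sum_v low u E * low v E)).
      by apply: eq_Ex => E _; rewrite expr2 big_distrlr.
    by rewrite Ex_sum; apply: eq_bigr => u _; rewrite Ex_sum.
  have lowM u v : Ex p A (fun E => low u E * low v E) =
      Ex p A (fun E => ((deg E u <= x) && (deg E v <= x))%N%:R).
    by apply: eq_Ex => E _; rewrite -natrM mulnb.
  apply: (@le_trans _ _ (\sum_(u : 'I_n) (bincdf p n.-1 x + n%:R * P2))).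
    apply: ler_sum => u _; rewrite (bigD1 u) //= lerD //.
      rewrite lowM /bincdf -(Ex_deg u); apply: le_Ex => // E _; by rewrite andbb.
    rewrite (eq_bigr (fun=> P2)) => [|v vu]; last by rewrite lowM Ex_low_pair // eq_sym.
    rewrite big_const iter_addr_0 -[P2 *+ _]mulr_natl ler_wpM2r // ler_nat.
    by rewrite -[X in (_ <= X)%N]card_ord max_card.
  by rewrite big_const iter_addr_0 card_ord -[leLHS]mulr_natl ME; lra.
(* On this event [X] vanishes, so its squared deviation from the mean is [M ^+ 2]. *)
have var : Ex p A (fun E => [forall v, x < deg E v]%N%:R) * M ^+ 2 <=
    Ex p A (fun E => X E ^+ 2) - M ^+ 2.
  apply: (@le_trans _ _ (Ex p A (fun E => (X E ^+ 2 + (- 2 * M) * X E) + M ^+ 2))).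
    rewrite [leLHS]mulrC -ExZ; apply: (le_Ex p01) => E _.
    have [/forallP H|_] := boolP [forall v, x < deg E v]%N.
      have -> : X E = 0 by apply: big1 => v _; rewrite /low leqNgt H.
      by rewrite expr0n mulr0 !add0r mulr1.
    by rewrite mulr0; have := sqr_ge0 (X E - M); lra.
  by rewrite !ExD ExZ EX Ex_const; lra.
have q0 : 0 <= 1 - p by rewrite subr_ge0.
apply: (@le_trans _ _ ((1 - p) * (M + n%:R ^+ 2 * P2 - M ^+ 2))).
  by rewrite ler_wpM2l // (le_trans var) // lerD2r.
have : n%:R ^+ 2 * ((1 - p) * P2) <= M ^+ 2 by rewrite ME exprMn ler_wpM2l ?sqr_ge0.
lra.
Qed.

End RandomGraph.

(** * Edge counts of the random graph *)

Section Tails.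
Variable R : realType.
Implicit Types (p u beta zeta : R).

Lemma expR_le_quad u : 0 <= u <= 1 / 2 -> expR u <= 1 + u + 2 * u ^+ 2.
Proof.
move=> /andP[u0 u1]; rewrite -[u in expR u]opprK expRN.
have h : 0 < 1 - u by lra.
apply: (@le_trans _ _ (1 - u)^-1).
  by rewrite lef_pV2 ?posrE ?expR_gt0 // (le_trans _ (expR_ge1Dx _)).
rewrite -[_^-1]mul1r ler_pdivrMr //.
have : 0 <= u ^+ 2 * (1 - 2 * u) by rewrite mulr_ge0 ?sqr_ge0 //; lra.
lra.
Qed.

Lemma expRN_le_quad u : 0 <= u -> expR (- u) <= 1 - u + u ^+ 2.
Proof.
move=> u0; rewrite expRN; have h : 0 < 1 + u by lra.
apply: (@le_trans _ _ (1 + u)^-1); first by rewrite lef_pV2 ?posrE ?expR_gt0 ?expR_ge1Dx.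
rewrite -[_^-1]mul1r ler_pdivrMr //.
have : 0 <= u ^+ 3 by rewrite exprn_ge0.
lra.
Qed.

(** Domination by an exponential serves both tails: [u > 0] for the upper one, [u < 0] for the lower
    one. *)
Lemma binE_chernoff p N phi u beta : 0 <= p <= 1 ->
  (forall j, phi j <= expR (u * (j%:R - beta))) ->
  binE p N phi <= expR (- (u * beta) + (expR u - 1) * (p * N%:R)).
Proof.
move=> p01 H; have [p0 p1] := andP p01.
apply: (@le_trans _ _ (binE p N (fun j => expR (- (u * beta)) * expR u ^+ j))).
  apply: le_binE => // j; rewrite -expRM_natl -expRD (le_trans (H j)) // ler_expR.
  by rewrite le_eqVlt; apply/orP; left; apply/eqP; ring.
rewrite binE_scale binE_geometric expRD ler_wpM2l ?expR_ge0 //.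
have -> : (expR u - 1) * (p * N%:R) = N%:R * ((expR u - 1) * p) by ring.
rewrite expRM_natl lerXn2r ?nnegrE ?expR_ge0 //.
  have := expR_gt0 u; nra.
apply: le_trans (expR_ge1Dx _); lra.
Qed.

Lemma expR_indicator u (b : bool) x : 0 <= u -> (b -> 0 <= x) -> b%:R <= expR (u * x).
Proof.
move=> u0; case: b => [/(_ isT) x0|_]; last by rewrite expR_ge0.
by rewrite (le_trans _ (expR_ge1Dx _)) // lerDl mulr_ge0.
Qed.

Lemma bin2R k : 'C(k, 2)%:R = k%:R * (k%:R - 1) / 2 :> R.
Proof.
case: k => [|k]; first by rewrite bin0n !mul0r.
have := bin_ffact k.+1 2; rewrite ffactnSr ffactn1 subn1 /= => h.
have : ('C(k.+1, 2) * 2)%:R = (k.+1 * k)%:R :> R by rewrite -h.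
rewrite !natrM -[k.+1%:R - 1]/(k.+1%:R - 1%:R) -natrB // subn1 /=; lra.
Qed.

Lemma Ex_exists (T I : finType) p (A : {set T}) (C : pred I) (P : I -> {set T} -> bool) :
  0 <= p <= 1 ->
  Ex p A (fun E => (~~ [forall i, C i ==> P i E])%:R) <=
  \sum_(i | C i) Ex p A (fun E => (~~ P i E)%:R).
Proof.
move=> p01; rewrite -Ex_sum; apply: le_Ex => // E _.
have [|] := boolP [forall i, C i ==> P i E]; first by rewrite sumr_ge0 // => i _; rewrite ler0n.
rewrite negb_forall => /existsP[i]; rewrite negb_imply => /andP[Ci nP].
by rewrite (bigD1 i) //= nP lerDl sumr_ge0 // => j _; rewrite ler0n.
Qed.

Section Graph.
Variables (n : nat) (p : R).
Hypothesis p01 : 0 <= p <= 1.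
Implicit Types (E : {set {set 'I_n}}) (S : {set 'I_n}).

Definition many_edges zeta E := (1 - zeta) * (p * 'C(n, 2)%:R) <= #|E|%:R.

Definition large_sets_light b zeta E :=
  [forall S : {set 'I_n}, (b < #|S|)%N ==>
     (#|induced E S|%:R <= (1 + zeta) * (p * 'C(#|S|, 2)%:R))].

Definition small_sets_sparse b g E :=
  [forall S : {set 'I_n}, (#|S| <= b)%N ==> (#|induced E S| <= g * #|S|)%N].

Lemma Ex_few_edges zeta : 0 <= zeta <= 1 ->
  Ex p (all_edges n) (fun E => (~~ many_edges zeta E)%:R) <=
  expR (- (zeta ^+ 2 / 4 * (p * 'C(n, 2)%:R))).
Proof.
move=> /andP[z0 z1]; set mu := p * _.
pose beta := (1 - zeta) * mu; have [p0 p1] := andP p01.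
have mu0 : 0 <= mu by rewrite mulr_ge0.
rewrite (@Ex_card _ p _ (all_edges n) (fun j => (~~ (beta <= j%:R))%:R)).
apply: le_trans (binE_chernoff (u := - (zeta / 2)) (beta := beta) _ p01 _) _.
  move=> j; have -> : - (zeta / 2) * (j%:R - beta) = zeta / 2 * (beta - j%:R) by ring.
  apply: expR_indicator; first by lra.
  by rewrite -ltNge => /ltW; lra.
rewrite ler_expR card_all_edges -/mu /beta.
have /expRN_le_quad h : 0 <= zeta / 2 by lra.
have : 0 <= mu * (1 - zeta / 2 + (zeta / 2) ^+ 2 - expR (- (zeta / 2))).
  by rewrite mulr_ge0 // subr_ge0.
lra.
Qed.

Lemma Ex_heavy_set zeta S : 0 <= zeta <= 1 ->
  Ex p (all_edges n)
    (fun E => (~~ (#|induced E S|%:R <= (1 + zeta) * (p * 'C(#|S|, 2)%:R)))%:R) <=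
  expR (- (zeta ^+ 2 / 8 * (p * 'C(#|S|, 2)%:R))).
Proof.
move=> /andP[z0 z1]; set mu := p * _.
pose beta := (1 + zeta) * mu; have [p0 p1] := andP p01.
have mu0 : 0 <= mu by rewrite mulr_ge0.
rewrite (@Ex_induced _ p n S (fun j => (~~ (j%:R <= beta))%:R)).
apply: le_trans (binE_chernoff (u := zeta / 4) (beta := beta) _ p01 _) _.
  by move=> j; apply: expR_indicator; [lra | rewrite -ltNge => /ltW; lra].
rewrite ler_expR -/mu /beta.
have /expR_le_quad h : 0 <= zeta / 4 <= 1 / 2 by apply/andP; split; lra.
have : 0 <= mu * (1 + zeta / 4 + 2 * (zeta / 4) ^+ 2 - expR (zeta / 4)).
  by rewrite mulr_ge0 // subr_ge0.
lra.
Qed.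

(** Union bound over all subsets, of which there are at most [expR n]. *)
Lemma Ex_large_sets_heavy b zeta : 0 <= zeta <= 1 ->
  Ex p (all_edges n) (fun E => (~~ large_sets_light b zeta E)%:R) <=
  expR (n%:R - zeta ^+ 2 / 8 * (p * (b%:R * b%:R / 2))).
Proof.
move=> z01; have [p0 p1] := andP p01.
apply: le_trans (Ex_exists _ _ _ p01) _.
set c := zeta ^+ 2 / 8 * _.
apply: (@le_trans _ _ (\sum_(S : {set 'I_n} | (b < #|S|)%N) expR (- c))).
  apply: ler_sum => S bS; apply: le_trans (Ex_heavy_set S z01) _.
  rewrite ler_expR lerN2 /c ler_wpM2l ?divr_ge0 ?sqr_ge0 // ler_wpM2l //.
  rewrite bin2R ler_wpM2r ?invr_ge0 ?ler0n // ler_pM ?ler0n //; first by rewrite ler_nat ltnW.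
  by rewrite lerBrDr natr1 ler_nat.
have e2 : 2%:R <= expR 1 :> R by apply: le_trans (expR_ge1Dx _); lra.
apply: (@le_trans _ _ (2%:R ^+ n * expR (- c))).
  rewrite big_const iter_addr_0 -[leLHS]mulr_natl ler_wpM2r ?expR_ge0 // -natrX ler_nat.
  apply: leq_trans (max_card _) _.
  by rewrite -[#|_|]cardsT -powersetT card_powerset cardsT card_ord.
rewrite expRD ler_wpM2r ?expR_ge0 // -[n%:R]mulr1 expRM_natl lerXn2r ?nnegrE //.
exact: expR_ge0.
Qed.

Lemma sum_powers_card (z : R) : \sum_(S : {set 'I_n}) z ^+ #|S| = (1 + z) ^+ n.
Proof.
have := @bigA_distr R 0 1 *%R +%R 'I_n (fun=> z) (fun=> 1).
rewrite prodr_const card_ord addrC => ->; apply: eq_bigr => S _.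
by rewrite -big_mkcond prodr_const.
Qed.

(** A Chernoff bound in which [expR u * b <= n] limits the exponential moment to [p * n / 2] per
    vertex. The form [z ^+ #|S|] lets the binomial theorem sum over all sets. *)
Lemma Ex_dense_set b g u S : 0 <= u -> (0 < #|S| <= b)%N -> expR u * b%:R <= n%:R ->
  Ex p (all_edges n) (fun E => (~~ (#|induced E S| <= g * #|S|)%N)%:R) <=
  expR (- (u * g%:R - p * n%:R / 2)) ^+ #|S|.
Proof.
move=> u0 /andP[S0 Sb] ub; have [p0 p1] := andP p01.
rewrite (@Ex_induced _ p n S (fun j => (~~ (j <= g * #|S|)%N)%:R)).
apply: le_trans (binE_chernoff (u := u) (beta := (g * #|S|)%:R) _ p01 _) _.
  move=> j; apply: expR_indicator => //.
  by rewrite -ltnNge subr_ge0 ler_nat; apply: ltnW.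
rewrite -expRM_natl ler_expR bin2R natrM.
have s1 : 1 <= #|S|%:R :> R by rewrite ler1n.
have sb : #|S|%:R <= b%:R :> R by rewrite ler_nat.
move: (#|S|%:R) s1 sb => s s1 sb.
have e0 := expR_gt0 u.
have h1 : expR u * s <= n%:R by apply: le_trans ub; rewrite ler_wpM2l // ltW.
have h2 : (expR u - 1) * (s - 1) <= n%:R by nra.
have h3 : 0 <= p * s * (n%:R - (expR u - 1) * (s - 1)).
  by rewrite !mulr_ge0 ?subr_ge0 //; lra.
lra.
Qed.

Lemma Ex_small_sets_dense b g u : 0 <= u -> expR u * b%:R <= n%:R ->
  Ex p (all_edges n) (fun E => (~~ small_sets_sparse b g E)%:R) <=
  (1 + expR (- (u * g%:R - p * n%:R / 2))) ^+ n - 1.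
Proof.
move=> u0 ub; set z := expR _.
apply: le_trans (Ex_exists _ _ _ p01) _.
(* The empty set is never dense, while it contributes the 1 that is subtracted on the right. *)
rewrite -sum_powers_card (bigD1 set0) ?cards0 //= [X in _ <= X - 1](bigD1 set0) //=.
rewrite [z ^+ _](_ : _ = 1) ?cards0 ?expr0 //.
rewrite (_ : Ex _ _ _ = 0) ?add0r; last first.
  rewrite -[RHS](Ex_const p (all_edges n)); apply: eq_Ex => E EA.
  rewrite ?cards0 muln0 leqn0 cards_eq0 (_ : induced E set0 = set0) ?eqxx //.
  apply/setP => e; rewrite !inE subset0; apply/negP => /andP[eE /eqP e0].
  by have := subsetP EA e eE; rewrite inE e0 cards0.
rewrite [leRHS]addrC addKr big_mkcondl /=; apply: ler_sum => S S0.
case: ifP => Sb; last by rewrite exprn_ge0 // expR_ge0.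
have S1 : (0 < #|S| <= b)%N by apply/andP; split; rewrite ?card_gt0.
exact: Ex_dense_set u0 S1 ub.
Qed.

End Graph.
End Tails.

(** * The two density regimes *)

Section Main.
Variable R : realType.

(** Balance of a set [S]: above size [b] by concentration; from 2 to [b] because
    [g * #|S| <= 2 * g * (#|S| - 1)] and [2 * g] is below the average density; a singleton spans no
    edge. *)
Lemma packable_of_events (n : nat) (p : R) (E : {set {set 'I_n}}) zeta b g y t :
  (1 < n)%N -> E \subset all_edges n -> 0 <= p <= 1 -> 0 <= zeta <= 1 ->
  many_edges p zeta E -> large_sets_light p b zeta E -> small_sets_sparse b g E ->
  separated E y ->
  (forall s : nat, (b < s)%N -> (s + b <= n)%N -> (1 + zeta) * s%:R <= (1 - zeta) * n%:R) ->
  2 * g%:R <= (1 - zeta) * (p * n%:R) / 2 ->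
  (forall v, t <= deg E v)%N -> (t * n.-1 <= #|E|)%N -> (t + 2 * g <= y)%N ->
  packable E t.
Proof.
move=> n1 EA /andP[p0 p1] /andP[z0 z1] many /forallP light /forallP sparse sep hs hg tdeg tE tgy.
have n1R : n.-1%:R = n%:R - 1 :> R by rewrite -subn1 natrB // ltnW.
have nn : 1 <= n%:R - 1 :> R by have : 2 <= n%:R :> R; [rewrite (ler_nat R 2)|lra].
apply: (packable_of_sparse (g := g) (b := b) EA tE _ _ tdeg sep tgy); last first.
  by move=> H; apply/implyP/sparse.
move=> S S0 Sb; have s1 : (0 < #|S|)%N by rewrite card_gt0.
rewrite -(ler_nat R) !natrM n1R.
have -> : #|S|.-1%:R = #|S|%:R - 1 :> R by rewrite -subn1 natrB.
move: many; rewrite /many_edges bin2R => many.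
have [sb|bs] := leqP #|S| b; last first.
  have /implyP/(_ bs) := light S; rewrite bin2R => lightS.
  have hS := hs _ bs Sb; move: lightS hS.
  have : 1 <= #|S|%:R :> R by rewrite ler1n.
  move: (#|S|%:R : R) (#|induced E S|%:R : R) (#|E|%:R : R) (n%:R : R) many nn => s e m N.
  move=> many nn s1' lightS hS.
  apply: (@le_trans _ _ ((1 + zeta) * (p * (s * (s - 1) / 2)) * (N - 1))).
    by rewrite ler_wpM2r //; lra.
  apply: (@le_trans _ _ ((1 - zeta) * (p * (N * (N - 1) / 2)) * (s - 1))).
    have : 0 <= p * (s - 1) * (N - 1) * ((1 - zeta) * N - (1 + zeta) * s).
      by rewrite !mulr_ge0 // subr_ge0 //; lra.
    lra.
  by rewrite ler_wpM2r //; lra.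
have [s2|s2] := leqP #|S| 1.
  rewrite (_ : #|induced E S| = 0)%N ?mul0r.
    by rewrite mulr_ge0 ?ler0n // subr_ge0 ler1n.
  apply/eqP; rewrite cards_eq0; apply/eqP/setP => e; rewrite !inE; apply/negP => /andP[eE eS].
  have := leq_trans (subset_leq_card eS) s2.
  by have := subsetP EA e eE; rewrite inE => /eqP ->.
have /implyP/(_ sb) := sparse S; rewrite -(ler_nat R) natrM => sparseS.
have : 2 <= #|S|%:R :> R by rewrite (ler_nat R 2).
move: sparseS; have : 0 <= g%:R :> R by [].
move: (#|S|%:R : R) (#|induced E S|%:R : R) (#|E|%:R : R) (n%:R : R) (g%:R : R) many nn hg => s e m N G.
move=> many nn hg G0 sparseS s2'.
have h1 : e * (N - 1) <= G * s * (N - 1) by rewrite ler_wpM2r //; lra.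
have h2 : 0 <= G * (N - 1) * (s - 2) by rewrite !mulr_ge0 //; lra.
have h3 : 0 <= (N - 1) * (s - 1) * ((1 - zeta) * (p * N) / 2 - 2 * G).
  by rewrite !mulr_ge0 ?subr_ge0 //; lra.
have h4 : 0 <= (m - (1 - zeta) * (p * (N * (N - 1) / 2))) * (s - 1).
  by rewrite mulr_ge0 // ?subr_ge0 //; lra.
lra.
Qed.

Section Constants.
(** With [g] about [theta * p * n], the choice of [u] makes [u * g] at least [10 * p * n], which
    beats the [p * n / 2] of the small-set bound; [a] ensures [expR u * b <= n]; [zeta] is small
    enough to balance sets of up to [n - b] vertices. *)
Variables theta u a zeta : R.
Hypotheses (theta01 : 0 < theta <= 1 / 32) (uE : u = 10 / theta)
  (aE : a = expR (- u)) (zetaE : zeta = a / 4).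

Let a01 : 0 < a <= 1.
Proof.
have [t0 _] := andP theta01.
by rewrite aE expR_gt0 -(expR0 R) ler_expR oppr_le0 uE divr_ge0 // ltW.
Qed.

Let zeta01 : 0 < zeta <= 1 / 4.
Proof. by have [a0 a1] := andP a01; rewrite zetaE; apply/andP; split; lra. Qed.

(* L is ln n, kept abstract so that every power of n is an exponential. *)
Variables (n : nat) (p L : R).
Hypotheses (p01 : 0 <= p <= 1) (nL : n%:R = expR L) (L_large : 320 <= zeta ^+ 2 * a ^+ 2 * L)
  (dL : 2 / 5 * L <= p * n%:R).

Let b := Num.truncn (a * n%:R).
Let g := (Num.truncn (theta * (p * n%:R))).+1.

Let za2_ge0 : 0 <= zeta ^+ 2 * a ^+ 2.
Proof. by rewrite mulr_ge0 // sqr_ge0. Qed.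

Lemma L_ge320 : 320 <= L.
Proof.
have [a0 a1] := andP a01; have [z0 z1] := andP zeta01.
have L0 : 0 <= L.
  rewrite leNgt; apply/negP => Ln; have : zeta ^+ 2 * a ^+ 2 * L <= 0.
    by rewrite mulr_ge0_le0 // ltW.
  by move/(le_trans L_large); rewrite lern0.
have za : zeta ^+ 2 * a ^+ 2 <= 1.
  by rewrite -exprMn expr_le1 ?mulr_ge0 ?mulr_ile1 //; lra.
by apply: le_trans L_large _; rewrite -[leRHS]mul1r ler_wpM2r.
Qed.

Let nL1 : L + 1 <= n%:R.
Proof. by rewrite nL addrC expR_ge1Dx. Qed.

Let an4 : 320 <= zeta ^+ 2 * a ^+ 2 * n%:R.
Proof.
apply: le_trans L_large _; rewrite ler_wpM2l ?za2_ge0 //.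
by apply: le_trans nL1; rewrite lerDl.
Qed.

Let an8 : 8 <= a * n%:R.
Proof.
have [a0 a1] := andP a01; have [z0 z1] := andP zeta01.
have n0 : 0 <= n%:R :> R by [].
have za : zeta ^+ 2 * a <= 1 by rewrite mulr_ile1 ?exprn_ge0 ?expr_le1 //; lra.
have : zeta ^+ 2 * a * (a * n%:R) <= a * n%:R.
  by rewrite -[leRHS]mul1r ler_wpM2r // mulr_ge0 // ltW.
by have := an4; lra.
Qed.

Let b_bounds : a * n%:R - 1 <= b%:R /\ b%:R <= a * n%:R.
Proof.
have an0 : 0 <= a * n%:R by have := an8; lra.
have /andP[h1 h2] := truncn_itv an0; split; last exact: h1.
by move: h2; rewrite -natr1 -/b; lra.
Qed.

Let g_bounds : theta * (p * n%:R) <= g%:R /\ g%:R <= theta * (p * n%:R) + 1.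
Proof.
have [t0 _] := andP theta01; have [p0 _] := andP p01.
have td0 : 0 <= theta * (p * n%:R) by rewrite !mulr_ge0 // ltW.
have /andP[h1 h2] := truncn_itv td0; split; first exact: ltW.
by rewrite /g -natr1 lerD2r.
Qed.

Lemma middle_size (s : nat) : (b < s)%N -> (s + b <= n)%N ->
  (1 + zeta) * s%:R <= (1 - zeta) * n%:R.
Proof.
move=> _; rewrite -(ler_nat R) natrD => sb.
have [a0 a1] := andP a01; have [h1 h2] := b_bounds.
(* The [+ 1] comes from truncating [a * n]; as [zeta = a / 4], a slack of about [a * n / 2] absorbs
   it. *)
have h : s%:R <= n%:R - a * n%:R + 1 by lra.
apply: (@le_trans _ _ ((1 + zeta) * (n%:R - a * n%:R + 1))).
  by rewrite ler_wpM2l // zetaE; lra.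
rewrite zetaE; have := an8; have : 0 <= a * a * n%:R by rewrite !mulr_ge0 // ltW.
nra.
Qed.

Lemma sparse_threshold : 2 * g%:R <= (1 - zeta) * (p * n%:R) / 2.
Proof.
have [_ h] := g_bounds; have [z0 z1] := andP zeta01; have [t0 t1] := andP theta01.
have d0 : 128 <= p * n%:R by have := L_ge320; have := dL; lra.
move: (p * n%:R) d0 h => d d0 h.
have : theta * d <= 1 / 32 * d by rewrite ler_wpM2r //; lra.
have : zeta * d <= 1 / 4 * d by rewrite ler_wpM2r //; lra.
lra.
Qed.

Lemma core_tails :
  Ex p (all_edges n) (fun E => (~~ many_edges p zeta E)%:R) +
  Ex p (all_edges n) (fun E => (~~ large_sets_light p b zeta E)%:R) +
  Ex p (all_edges n) (fun E => (~~ small_sets_sparse b g E)%:R) <= 4 * expR (- L).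
Proof.
have [a0 a1] := andP a01; have [z0 z1] := andP zeta01; have [t0 t1] := andP theta01.
have [b1 b2] := b_bounds; have [g1 g2] := g_bounds.
have z01 : 0 <= zeta <= 1 by apply/andP; split; lra.
have zaL := L_large; have L3 := L_ge320; have nL1' := nL1.
have [p0 p1] := andP p01.
set d := p * n%:R in g1 g2; have d1 : 2 / 5 * L <= d := dL.
have T1 : Ex p (all_edges n) (fun E => (~~ many_edges p zeta E)%:R) <= expR (- L).
  apply: le_trans (Ex_few_edges n p01 z01) _; rewrite ler_expR lerN2 bin2R.
  have -> : zeta ^+ 2 / 4 * (p * (n%:R * (n%:R - 1) / 2)) = zeta ^+ 2 / 8 * d * (n%:R - 1).
    by rewrite /d; lra.
  have h1 : 320 <= zeta ^+ 2 * L.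
    have L0 : 0 <= zeta ^+ 2 * L by apply: mulr_ge0 (sqr_ge0 _) _; lra.
    have a21 : a ^+ 2 <= 1 by rewrite expr_le1 // ltW.
    by apply: le_trans zaL _; rewrite mulrAC ler_piMr.
  have h2 : 16 <= zeta ^+ 2 / 8 * d.
    have : zeta ^+ 2 * (2 / 5 * L) <= zeta ^+ 2 * d by rewrite ler_wpM2l // sqr_ge0.
    lra.
  have : 1 * (n%:R - 1) <= zeta ^+ 2 / 8 * d * (n%:R - 1) by rewrite ler_wpM2r; lra.
  lra.
have T2 : Ex p (all_edges n) (fun E => (~~ large_sets_light p b zeta E)%:R) <= expR (- L).
  apply: le_trans (Ex_large_sets_heavy n p01 b z01) _; rewrite ler_expR.
  have an : 8 <= a * n%:R := an8.
  have bb : (a * n%:R / 2) * (a * n%:R / 2) <= b%:R * b%:R by rewrite ler_pM //; lra.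
  have h1 : zeta ^+ 2 / 8 * (p * ((a * n%:R / 2) * (a * n%:R / 2) / 2)) <=
            zeta ^+ 2 / 8 * (p * (b%:R * b%:R / 2)).
    by rewrite ler_wpM2l ?divr_ge0 ?sqr_ge0 // ler_wpM2l // ler_wpM2r ?invr_ge0.
  have h2 : zeta ^+ 2 / 8 * (p * ((a * n%:R / 2) * (a * n%:R / 2) / 2)) =
            zeta ^+ 2 * a ^+ 2 * d * n%:R / 64 by rewrite /d; lra.
  (* After division by 64 the exponent gains [2 * n], which outweighs the [n] of the union bound
     over subsets. *)
  have h3 : 128 <= zeta ^+ 2 * a ^+ 2 * d.
    have : zeta ^+ 2 * a ^+ 2 * (2 / 5 * L) <= zeta ^+ 2 * a ^+ 2 * d.
      by rewrite ler_wpM2l // za2_ge0.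
    lra.
  have : 128 * n%:R <= zeta ^+ 2 * a ^+ 2 * d * n%:R by rewrite ler_wpM2r.
  lra.
have T3 : Ex p (all_edges n) (fun E => (~~ small_sets_sparse b g E)%:R) <= 2 * expR (- L).
  have u0 : 0 <= u by rewrite uE divr_ge0 // ltW.
  have ub : expR u * b%:R <= n%:R.
    apply: (@le_trans _ _ (expR u * (a * n%:R))); first by rewrite ler_wpM2l // expR_ge0.
    by rewrite mulrA aE -expRD subrr expR0 mul1r.
  apply: le_trans (Ex_small_sets_dense p01 g u0 ub) _; set z := expR _.
  (* Here [u * g >= 10 * d] with [d >= 2 / 5 * L]; then [z * n <= expR (- L)], and
     [(1 + z) ^+ n - 1] is of the same order. *)
  have z2 : z <= expR (- (2 * L)).
    rewrite ler_expR lerN2 -/d.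
    have : u * (theta * d) <= u * g%:R by rewrite ler_wpM2l.
    have -> : u * (theta * d) = 10 * d by rewrite uE mulrA divfK // gt_eqF.
    lra.
  have zn : z * n%:R <= expR (- L).
    apply: (@le_trans _ _ (expR (- (2 * L)) * n%:R)); first by rewrite ler_wpM2r.
    by rewrite nL -expRD ler_expR; lra.
  have z0' : 0 <= z by apply: expR_ge0.
  have half : expR (- L) <= 1 / 2.
    rewrite expRN -[_^-1]mul1r ler_pdivrMr ?expR_gt0 // -nL; lra.
  apply: (@le_trans _ _ (expR (expR (- L)) - 1)).
    rewrite lerD2r; apply: (@le_trans _ _ (expR z ^+ n)).
      by rewrite lerXn2r ?nnegrE ?expR_ge0 ?expR_ge1Dx // addr_ge0.
    by rewrite -expRM_natr ler_expR.
  have x0 : 0 <= expR (- L) by apply: expR_ge0.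
  have /expR_le_quad : 0 <= expR (- L) <= 1 / 2 by rewrite x0.
  move: (expR (- L)) half x0 => x half x0; nra.
lra.
Qed.

End Constants.
End Main.

(** * Tail estimates for low vertices in the dense and sparse ranges *)

Section Regimes.
Variable R : realType.

(** Lets a small exponential absorb polynomial factors in [L] or [p * n]. *)
Lemma le_scaled_expR (k x : R) : 0 < k -> x <= k * expR (x / k).
Proof.
move=> k0; have := expR_ge1Dx (x / k); rewrite -(ler_pM2l k0) mulrDr mulrCA divff ?gt_eqF //.
lra.
Qed.

Variables (n : nat) (p L : R).
Hypotheses (p01 : 0 <= p <= 1) (nL : n%:R = expR L) (L320 : 320 <= L).

Let nL1 : L + 1 <= n%:R.
Proof. by rewrite nL addrC expR_ge1Dx. Qed.

Let n_ge3 : (3 <= n)%N.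
Proof. by rewrite -(ler_nat R); have := nL1; have := L320; lra. Qed.

Let predn3 : n.-1 = (n - 3).+2.
Proof. by case: n n_ge3 => [|[|[|m]]] // _; rewrite /= !subSS subn0. Qed.

(** With [d = p * n], the prefactor is at most a constant times [expR (L + d / 50)] and the squared
    Chernoff bound is about [expR (- (2 * d / 25))]; [d >= 40 * L] makes the product small. *)
Lemma sep_tail_dense y : 40 * L <= p * n%:R -> y%:R <= 3 / 5 * (p * n%:R) ->
  (n%:R ^+ 2 * p + n%:R ^+ 3 * p ^+ 2) * bincdf p (n - 3) y ^+ 2 <=
  2 * 100 ^+ 2 * expR 1 * expR (- L).
Proof.
have [p0 p1] := andP p01; have nn := nL1; have LL := L320.
set d := p * n%:R => dL yd.
have F : bincdf p (n - 3) y <= expR (1 / 2 - d / 25).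
  apply: le_trans (binE_chernoff (u := - (1 / 5)) (beta := y%:R) _ p01 _) _.
    move=> j; have -> : - (1 / 5) * (j%:R - y%:R) = 1 / 5 * (y%:R - j%:R) :> R by ring.
    by apply: expR_indicator; [lra|rewrite subr_ge0 ler_nat].
  rewrite ler_expR natrB //.
  have /expRN_le_quad h : 0 <= 1 / 5 :> R by lra.
  have pn : 0 <= p * (n%:R - 3) by rewrite mulr_ge0 //; lra.
  have : (expR (- (1 / 5)) - 1) * (p * (n%:R - 3)) <= - (4 / 25) * (p * (n%:R - 3)).
    by rewrite ler_wpM2r //; lra.
  by rewrite /d in yd *; lra.
have F2 : bincdf p (n - 3) y ^+ 2 <= expR (1 - 2 * d / 25).
  apply: (@le_trans _ _ (expR (1 / 2 - d / 25) ^+ 2)).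
    by rewrite lerXn2r ?nnegrE ?bincdf_ge0 ?expR_ge0.
  by rewrite -expRM_natl ler_expR; lra.
have d100 : d <= 100 * expR (d / 100) by apply: le_scaled_expR; lra.
have d2 : d ^+ 2 <= 100 ^+ 2 * expR (d / 50).
  apply: (@le_trans _ _ ((100 * expR (d / 100)) ^+ 2)).
    by rewrite lerXn2r ?nnegrE ?mulr_ge0 ?expR_ge0 //; lra.
  by rewrite exprMn -expRM_natl ler_wpM2l ?sqr_ge0 // ler_expR; lra.
have pref : n%:R ^+ 2 * p + n%:R ^+ 3 * p ^+ 2 <= n%:R * (2 * (100 ^+ 2 * expR (d / 50))).
  have -> : n%:R ^+ 2 * p + n%:R ^+ 3 * p ^+ 2 = n%:R * (d + d ^+ 2) by rewrite /d; ring.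
  rewrite ler_wpM2l //; have : d <= d ^+ 2 by rewrite expr2 ler_peMl; lra.
  lra.
have pref0 : 0 <= n%:R ^+ 2 * p + n%:R ^+ 3 * p ^+ 2.
  by rewrite addr_ge0 // mulr_ge0 ?exprn_ge0.
apply: (le_trans (ler_pM pref0 (sqr_ge0 _) pref F2)).
have -> : n%:R * (2 * (100 ^+ 2 * expR (d / 50))) * expR (1 - 2 * d / 25) =
   2 * 100 ^+ 2 * (expR L * expR (d / 50) * expR (1 - 2 * d / 25)) by rewrite nL; ring.
rewrite -!expRD -[leRHS]mulrA -expRD ler_wpM2l ?mulr_ge0 ?sqr_ge0 // ler_expR; lra.
Qed.

Lemma le_sqr_L : L ^+ 2 <= 400 * expR (L / 10).
Proof.
have LL := L320; have L20 : L <= 20 * expR (L / 20) by apply: le_scaled_expR; lra.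
apply: (@le_trans _ _ ((20 * expR (L / 20)) ^+ 2)).
  by rewrite lerXn2r ?nnegrE ?mulr_ge0 ?expR_ge0 //; lra.
rewrite exprMn -expRM_natl; have -> : 2%:R * (L / 20) = L / 10 by lra.
by rewrite ler_wpM2r ?expR_ge0 //; lra.
Qed.

Lemma p_half : p * n%:R <= 40 * L -> p <= 1 / 2.
Proof.
move=> dL; have LL := L320; have [p0 p1] := andP p01.
have n80 : 80 * L <= n%:R.
  have h := expR_ge1Dx (L / 2).
  have : (1 + L / 2) ^+ 2 <= n%:R.
    rewrite nL (_ : expR L = expR (L / 2) ^+ 2); last by rewrite -expRM_natl; congr expR; lra.
    by rewrite lerXn2r ?nnegrE ?expR_ge0 //; lra.
  nra.
rewrite leNgt; apply/negP => p2.
have : 1 / 2 * n%:R < p * n%:R by rewrite ltr_pM2r //; lra.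
by lra.
Qed.

(** Shift with [a = expR (- 800)]: the choice of [theta] keeps [800 * (2 * g + 3)] below [L / 10]
    plus a constant, and the other factor costs at most [expR (L / 10)]. The squared tail still
    beats the prefactor. *)
Lemma sep_tail_sparse x g theta : p * n%:R <= 40 * L ->
  800 * 800 * theta = 1 -> g%:R <= theta * (p * n%:R) + 1 ->
  n%:R * bincdf p n.-1 x <= expR (L / 10) ->
  (n%:R ^+ 2 * p + n%:R ^+ 3 * p ^+ 2) * bincdf p (n - 3) (x.+1 + 2 * g) ^+ 2 <=
  1600 * 800 * expR (10 * 800) * expR (- (L / 10)).
Proof.
move=> dL theta_eq gd Qx; have [p0 p1] := andP p01; have nn := nL1; have LL := L320.
have p2 := p_half dL; set d := p * n%:R in dL gd.
have d0 : 0 <= d by rewrite mulr_ge0.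
set v : R := 800.
pose al := expR (- v).
have al01 : 0 < al <= 1 by rewrite expR_gt0 -(expR0 R) ler_expR /v; lra.
have al80 : 80 * al <= 1 / 10.
  have : al <= 1 / 801.
    rewrite /al expRN -[_^-1]mul1r ler_pdivrMr ?expR_gt0 //.
    have := expR_ge1Dx v; rewrite /v; lra.
  lra.
have Q1 : bincdf p n.-1 x <= expR (L / 10 - L).
  rewrite expRD expRN -nL ler_pdivlMr; last by lra.
  by rewrite mulrC.
have F : bincdf p (n - 3) (x.+1 + 2 * g) <= expR (3 / 10 * L - L + 5 * 800).
  (* Passing from [n - 3] to [n - 1] trials adds at most two successes. *)
  apply: (@le_trans _ _ (bincdf p n.-1 (x + (2 * g + 3)))).
    rewrite predn3 (_ : x + (2 * g + 3) = (x.+1 + 2 * g).+2)%N; last first.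
      by rewrite addSn addnA !addnS addn0.
    by apply: le_trans (bincdf_leSS p01 _ _) (bincdf_leSS p01 _ _).
  have p_lt1 : p < 1 by lra.
  apply: le_trans (bincdf_shift p01 _ _ _ p_lt1 al01) _.
  have A1 : al^-1 ^+ (2 * g + 3) <= expR (L / 10 + 5 * 800).
    rewrite /al expRN invrK -expRM_natl ler_expR natrD natrM.
    have : theta * d <= theta * (40 * L) by rewrite ler_wpM2l //; lra.
    rewrite /v; nra.
  have A2 : (1 + al * (p / (1 - p))) ^+ n.-1 <= expR (L / 10).
    have q0 : 0 <= p / (1 - p) by rewrite divr_ge0 //; lra.
    have r2 : p / (1 - p) <= 2 * p by rewrite ler_pdivrMr; [nra|lra].
    have [al0 _] := andP al01.
    apply: (@le_trans _ _ (expR (al * (2 * p)) ^+ n.-1)).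
      have base : 1 + al * (p / (1 - p)) <= expR (al * (2 * p)).
        by rewrite (le_trans (expR_ge1Dx _)) // ler_expR ler_wpM2l // ltW.
      have base0 : 0 <= 1 + al * (p / (1 - p)) by rewrite addr_ge0 // mulr_ge0 // ltW.
      by rewrite lerXn2r ?nnegrE ?expR_ge0.
    rewrite -expRM_natl ler_expR.
    have n1 : n.-1%:R <= n%:R :> R by rewrite ler_nat leq_pred.
    have : n.-1%:R * (al * (2 * p)) <= n%:R * (al * (2 * p)).
      by rewrite ler_wpM2r // !mulr_ge0 // ltW.
    have : al * d <= al * (40 * L) by rewrite ler_wpM2l // ltW.
    have : 80 * al * L <= 1 / 10 * L by rewrite ler_wpM2r //; lra.
    rewrite /d; lra.
  have e1 : 0 <= al^-1 ^+ (2 * g + 3) by rewrite exprn_ge0 // invr_ge0 expR_ge0.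
  have e2 : 0 <= (1 + al * (p / (1 - p))) ^+ n.-1.
    rewrite exprn_ge0 // addr_ge0 // mulr_ge0 ?expR_ge0 // divr_ge0 //; lra.
  have := ler_pM (bincdf_ge0 p01 n.-1 x) (mulr_ge0 e1 e2) Q1 (ler_pM e1 e2 A1 A2).
  by move/le_trans; apply; rewrite -!expRD ler_expR; lra.
have F2 : bincdf p (n - 3) (x.+1 + 2 * g) ^+ 2 <= expR (6 / 10 * L - 2 * L + 10 * 800).
  apply: (@le_trans _ _ (expR (3 / 10 * L - L + 5 * 800) ^+ 2)).
    by rewrite lerXn2r ?nnegrE ?bincdf_ge0 ?expR_ge0.
  by rewrite -expRM_natl ler_expR; lra.
have pref : n%:R ^+ 2 * p + n%:R ^+ 3 * p ^+ 2 <= n%:R * (1600 * 800 * expR (L / 10)).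
  have -> : n%:R ^+ 2 * p + n%:R ^+ 3 * p ^+ 2 = n%:R * (d + d ^+ 2) by rewrite /d; ring.
  rewrite ler_wpM2l //.
  have h1 : d ^+ 2 <= (40 * L) ^+ 2 by rewrite lerXn2r ?nnegrE //; lra.
  have h2 : 40 * L <= (40 * L) ^+ 2 by rewrite expr2 ler_peMl; lra.
  have := le_sqr_L; lra.
have pref0 : 0 <= n%:R ^+ 2 * p + n%:R ^+ 3 * p ^+ 2.
  by rewrite addr_ge0 // mulr_ge0 ?exprn_ge0.
apply: (le_trans (ler_pM pref0 (sqr_ge0 _) pref F2)).
have -> : n%:R * (1600 * 800 * expR (L / 10)) * expR (6 / 10 * L - 2 * L + 10 * 800) =
   1600 * 800 * (expR L * expR (L / 10) * expR (6 / 10 * L - 2 * L + 10 * 800)).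
  by rewrite nL; ring.
rewrite -!expRD -[leRHS]mulrA -expRD ler_wpM2l ?mulr_ge0 // ler_expR; lra.
Qed.

(** Chebyshev gives at most [1 / M + 2 * p] since [p <= 1 / 2], and [p] is of order
    [L * expR (- L)]. *)
Lemma mindeg_tail x : p * n%:R <= 40 * L -> expR (L / 10) <= n%:R * bincdf p n.-1 x ->
  Ex p (all_edges n) (fun E => [forall v, x < deg E v]%N%:R) <= 1601 * expR (- (L / 10)).
Proof.
move=> dL QM; have [p0 p1] := andP p01; have LL := L320; have p2 := p_half dL.
have n1 : (1 < n)%N by apply: leq_trans n_ge3.
have := Ex_mindeg_gt p01 n1 (erefl (n%:R * bincdf p n.-1 x)).
set Pr := Ex _ _ _; set M := n%:R * _ in QM *; move=> var.
have M0 : 0 < M by apply: lt_le_trans QM; apply: expR_gt0.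
have h1 : Pr * M ^+ 2 <= M + 2 * p * M ^+ 2.
  have q0 : 0 < 1 - p by lra.
  have : p * M ^+ 2 <= (1 - p) * (2 * p) * M ^+ 2 by rewrite ler_wpM2r ?sqr_ge0 //; nra.
  by move=> h; rewrite -(ler_pM2l q0); apply: le_trans var _; lra.
have h2 : Pr <= M^-1 + 2 * p.
  rewrite -(ler_pM2r (exprn_gt0 2 M0)) (le_trans h1) // [leRHS]mulrDl lerD2r.
  by rewrite expr2 mulrA mulVf ?mul1r // gt_eqF.
have h3 : M^-1 <= expR (- (L / 10)) by rewrite expRN lef_pV2 ?posrE ?expR_gt0.
have h4 : 2 * p <= 1600 * expR (- (L / 10)).
  have L20 : L <= 20 * expR (L / 20) by apply: le_scaled_expR; lra.
  have -> : p = p * n%:R * expR (- L) by rewrite -mulrA nL -expRD subrr expR0 mulr1.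
  apply: (@le_trans _ _ (2 * (40 * (20 * expR (L / 20)) * expR (- L)))).
    rewrite ler_wpM2l // ler_wpM2r ?expR_ge0 //; lra.
  have -> : 2 * (40 * (20 * expR (L / 20)) * expR (- L)) =
     1600 * (expR (L / 20) * expR (- L)) by ring.
  by rewrite -expRD ler_wpM2l // ler_expR; lra.
lra.
Qed.

(** Isolated vertices alone already obey the bound, and [1 - p >= expR (- (2 * p))] turns it into
    [2 * p * n >= 9 / 10 * L]. *)
Lemma average_degree_ge x : p * n%:R <= 40 * L -> n%:R * bincdf p n.-1 x <= expR (L / 10) ->
  2 / 5 * L <= p * n%:R.
Proof.
move=> dL Qx; have [p0 p1] := andP p01; have LL := L320; have p2 := p_half dL.
have : n%:R * bincdf p n.-1 0 <= expR (L / 10).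
  by apply: le_trans Qx; rewrite ler_wpM2l // le_bincdf.
rewrite bincdf0 => Q0.
have e : expR (- (2 * p)) <= 1 - p.
  rewrite expRN -[_^-1]mul1r ler_pdivrMr ?expR_gt0 //.
  have h := expR_ge1Dx (2 * p).
  have : (1 - p) * (1 + 2 * p) <= (1 - p) * expR (2 * p) by rewrite ler_wpM2l //; lra.
  nra.
have : n%:R * expR (- (2 * p)) ^+ n.-1 <= expR (L / 10).
  apply: le_trans Q0; rewrite ler_wpM2l // lerXn2r ?nnegrE ?expR_ge0 //; lra.
rewrite -expRM_natl {1}nL -expRD ler_expR.
have : n.-1%:R * p <= n%:R * p by rewrite ler_wpM2r // ler_nat leq_pred.
lra.
Qed.

End Regimes.

(** * Failure probability of the packing formula *)

Section Final.
Variable R : realType.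

Lemma gnp_prob_compl (n : nat) (p : R) (P : {set {set 'I_n}} -> Prop) :
  1 - gnp_prob p P = Ex p (all_edges n) (fun E => (~~ `[< P E >])%:R).
Proof.
have -> : gnp_prob p P = Ex p (all_edges n) (fun E => (`[< P E >])%:R).
  rewrite /gnp_prob big_mkcondr; apply: eq_bigr => E _.
  by case: asboolP => _; rewrite ?mulr1 ?mulr0.
apply/eqP; rewrite subr_eq -ExD -[X in X == _](Ex_const p (all_edges n) 1).
by apply/eqP/eq_Ex => E _; case: asboolP => _; rewrite ?addr0 ?add0r.
Qed.

Section Failure.
Variables (theta u a zeta p L : R) (n : nat).
Hypotheses (theta01 : 0 < theta <= 1 / 32) (uE : u = 10 / theta)
  (aE : a = expR (- u)) (zetaE : zeta = a / 4) (p01 : 0 <= p <= 1) (nL : n%:R = expR L)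
  (L_large : 320 <= zeta ^+ 2 * a ^+ 2 * L).

Let b := Num.truncn (a * n%:R).
Let g := (Num.truncn (theta * (p * n%:R))).+1.

Lemma zeta_small : 0 < zeta <= 1 / 1000 /\ a <= 1.
Proof.
have [t0 t1] := andP theta01.
have u320 : 320 <= u by rewrite uE ler_pdivlMr //; lra.
have : a <= 1 / 321.
  rewrite aE expRN -[_^-1]mul1r ler_pdivrMr ?expR_gt0 //.
  have := expR_ge1Dx u; lra.
have : 0 < a by rewrite aE expR_gt0.
by rewrite zetaE; split; [apply/andP; split|]; lra.
Qed.

(** Common to both regimes: [T] is the extra event that brings the target below [y - 2 * g], trivial
    when dense and the presence of a low vertex when sparse. *)
Lemma Ex_stp_fail (T : {set {set 'I_n}} -> bool) y : 2 / 5 * L <= p * n%:R ->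
  (forall E : {set {set 'I_n}}, E \subset all_edges n -> large_sets_light p b zeta E -> T E ->
     (minn (mindeg E) (nedges E %/ n.-1) + 2 * g <= y)%N) ->
  Ex p (all_edges n) (fun E => (~~ `[< stp_event E >])%:R) <=
  4 * expR (- L) + (n%:R ^+ 2 * p + n%:R ^+ 3 * p ^+ 2) * bincdf p (n - 3) y ^+ 2 +
  Ex p (all_edges n) (fun E => (~~ T E)%:R).
Proof.
move=> dL ty; have [/andP[z0 z1] a1] := zeta_small.
have z01 : 0 <= zeta <= 1 by apply/andP; split; lra.
have n1 : (1 < n)%N.
  rewrite -(ltr_nat R) nL; have := expR_ge1Dx L; have := L_ge320 theta01 uE aE zetaE L_large; lra.
have core := core_tails theta01 uE aE zetaE p01 nL L_large dL.
have sep := @Ex_not_separated R p n p01 y.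
apply: le_trans _ (lerD (lerD core sep) (lexx _)).
rewrite -!ExD; apply: le_Ex => // E EA.
set b1 := many_edges _ _ _; set b2 := large_sets_light _ _ _ _.
set b3 := small_sets_sparse _ _ _; set b4 := separated _ _.
have good : [&& b1, b2, b3, b4 & T E] -> stp_event E.
  case/and5P=> h1 h2 h3 h4 h5; apply: stp_event_of_packable => //.
  apply: (packable_of_events n1 EA p01 z01 h1 h2 h3 h4) => //.
  - exact: (middle_size theta01 uE aE zetaE nL L_large).
  - exact: (sparse_threshold theta01 uE aE zetaE p01 L_large dL).
  - by move=> v; rewrite (leq_trans (geq_minl _ _)) // mindeg_leq.
  - by rewrite (leq_trans _ (leq_trunc_div #|E| n.-1)) // leq_mul2r geq_minr orbT.
  - exact: ty.
case: asboolP => [_|bad]; first by rewrite !addr_ge0 ?ler0n.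
have : ~~ [&& b1, b2, b3, b4 & T E] by apply/negP => /good.
by clear good; case: b1 b2 b3 b4 (T E) => [] [] [] [] [] //= _; rewrite -!natrD ler_nat.
Qed.

Lemma Ex_stp_fail_dense : 40 * L <= p * n%:R ->
  Ex p (all_edges n) (fun E => (~~ `[< stp_event E >])%:R) <=
  (4 + 2 * 100 ^+ 2 * expR 1) * expR (- L).
Proof.
move=> dL; have L320 := L_ge320 theta01 uE aE zetaE L_large; have [/andP[z0 z1] a1] := zeta_small.
have [p0 p1] := andP p01; have [t0 t1] := andP theta01.
pose w := (1 + zeta) * (p * n%:R) / 2.
have w0 : 0 <= w by rewrite /w divr_ge0 // mulr_ge0 //; lra.
pose y := (Num.truncn w + 2 * g)%N.
have n1 : (1 < n)%N by rewrite -(ltr_nat R) nL; have := expR_ge1Dx L; lra.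
have td0 : 0 <= theta * (p * n%:R) by rewrite mulr_ge0 ?ltW //; lra.
have g1 : g%:R <= theta * (p * n%:R) + 1.
  by rewrite /g -natr1 lerD2r; have /andP[] := truncn_itv td0.
have yd : y%:R <= 3 / 5 * (p * n%:R).
  have /andP[w1 _] := truncn_itv w0.
  rewrite /y natrD natrM; move: w1; rewrite {2}/w.
  have : theta * (p * n%:R) <= 1 / 32 * (p * n%:R) by rewrite ler_wpM2r //; lra.
  have : zeta * (p * n%:R) <= 1 / 1000 * (p * n%:R) by rewrite ler_wpM2r //; lra.
  lra.
have dL' : 2 / 5 * L <= p * n%:R by lra.
apply: le_trans (Ex_stp_fail (T := xpredT) (y := y) dL' _) _.
  move=> E EA light _; rewrite leq_add2r truncn_ge_nat // /w.
  set t := minn _ _.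
  have tE : (t * n.-1 <= #|E|)%N.
    by rewrite (leq_trans _ (leq_trunc_div #|E| n.-1)) // leq_mul2r geq_minr orbT.
  have bn : (b < n)%N.
    rewrite /b truncn_lt_nat; last by rewrite mulr_ge0 // aE expR_ge0.
    rewrite -[ltRHS]mul1r ltr_pM2r ?nL ?expR_gt0 //.
    by move: z1; rewrite zetaE; lra.
  (* Lightness of the whole vertex set is the upper bound on the number of edges, whence
     [t <= w]. *)
  have /forallP/(_ [set: 'I_n]) := light; rewrite cardsT card_ord bn /= bin2R.
  have -> : induced E [set: 'I_n] = E by apply/setP => e; rewrite inE finset.subsetT andbT.
  have n1R : n.-1%:R = n%:R - 1 :> R by rewrite -subn1 natrB // ltnW.
  move: tE; rewrite -(ler_nat R) natrM n1R => h1 h2.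
  have n2 : 0 < n%:R - 1 :> R by rewrite subr_gt0 ltr1n.
  rewrite -(ler_pM2r n2) (le_trans h1) // (le_trans h2) //; lra.
rewrite [Ex _ _ (fun=> _)](_ : _ = 0) ?Ex_const // addr0 [leRHS]mulrDl lerD2l.
exact: sep_tail_dense.
Qed.

Lemma Ex_stp_fail_sparse : 800 * 800 * theta = 1 -> p * n%:R <= 40 * L ->
  Ex p (all_edges n) (fun E => (~~ `[< stp_event E >])%:R) <=
  (4 + 1600 * 800 * expR (10 * 800) + 1601) * expR (- (L / 10)).
Proof.
move=> theta_eq dL; have L320 := L_ge320 theta01 uE aE zetaE L_large; have [p0 p1] := andP p01.
have [t0 t1] := andP theta01.
(* Every degree is at most [n], so at [x = n] the expected count is [n] itself. *)
have exq : exists x, expR (L / 10) <= n%:R * bincdf p n.-1 x.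
  exists n; rewrite bincdf_full ?leq_pred // mulr1 nL ler_expR; lra.
have eL : expR (- L) <= expR (- (L / 10)) by rewrite ler_expR; lra.
have e0 : 0 <= expR (- (L / 10)) by apply: expR_ge0.
have k0 : 0 <= 1600 * 800 * expR (10 * 800) * expR (- (L / 10)) :> R.
  by rewrite !mulr_ge0 ?expR_ge0.
pose T x (E : {set {set 'I_n}}) := ~~ [forall v, x < deg E v]%N.
(* x is the threshold at which vertices of degree at most x start to exist; below it they are so
   rare that even those of degree at most x + 2 g are far apart.  If x = 0, there
   is an isolated vertex with high probability, and the claim is trivial. *)
case: (ex_minnP exq) => x hx xmin.
have tail : Ex p (all_edges n) (fun E => (~~ T x E)%:R) <= 1601 * expR (- (L / 10)).
  under eq_Ex do rewrite negbK.
  exact: mindeg_tail.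
case: x => [|x] in hx xmin tail *.
  apply: (@le_trans _ _ (Ex p (all_edges n) (fun E => (~~ T 0%N E)%:R))); last by lra.
  have n1 : (1 < n)%N by rewrite -(ltr_nat R) nL; have := expR_ge1Dx L; lra.
  apply: le_Ex => // E EA; rewrite ler_nat; case TE: (T 0%N E); last by case: `[< _ >].
  case: asboolP => // -[]; apply: stp_event_of_packable => //.
  move: TE; rewrite /T negb_forall => /existsP[v]; rewrite -leqNgt leqn0 => /eqP v0.
  have -> : minn (mindeg E) (nedges E %/ n.-1) = 0%N.
    by apply/eqP; rewrite -leqn0 -v0 (leq_trans (geq_minl _ _)) // mindeg_leq.
  exact: packable0.
(* By minimality of [x.+1], the rarity bound still holds at [x], where the shift starts. *)
have hx' : n%:R * bincdf p n.-1 x <= expR (L / 10).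
  by rewrite leNgt; apply/negP => /ltW/xmin; rewrite ltnn.
have dL' := average_degree_ge p01 nL L320 dL hx'.
apply: le_trans (Ex_stp_fail (T := T x.+1) (y := x.+1 + 2 * g) dL' _) _.
  move=> E EA _; rewrite /T negb_forall => /existsP[v]; rewrite -leqNgt => dv.
  by rewrite leq_add2r (leq_trans (geq_minl _ _)) // (leq_trans (mindeg_leq E v)).
have td0 : 0 <= theta * (p * n%:R).
  by apply: mulr_ge0; [exact: ltW|exact: mulr_ge0].
have g1 : g%:R <= theta * (p * n%:R) + 1.
  by rewrite /g -natr1 lerD2r; have /andP[] := truncn_itv td0.
have := sep_tail_sparse p01 nL L320 dL theta_eq g1 hx'.
lra.
Qed.

End Failure.

(** The failure probability is of order [n ^ (-1/10)] uniformly in [p], hence along any sequence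
    [p n]. *)
Lemma gnp_prob_stp_event : exists C L0 : R, 0 < C /\ forall (n : nat) (p L : R),
  0 <= p <= 1 -> n%:R = expR L -> L0 <= L ->
  1 - gnp_prob p (@stp_event n) <= C * expR (- (L / 10)).
Proof.
pose theta : R := (800 * 800)^-1.
have theta_eq : 800 * 800 * theta = 1 by rewrite /theta mulfV // gt_eqF // mulr_gt0.
have theta01 : 0 < theta <= 1 / 32 by apply/andP; split; lra.
pose u := 10 / theta; pose a := expR (- u); pose zeta := a / 4.
have a0 : 0 < a by apply: expR_gt0.
have za0 : 0 < zeta ^+ 2 * a ^+ 2 by rewrite mulr_gt0 // exprn_gt0 // /zeta divr_gt0.
pose C1 : R := 4 + 2 * 100 ^+ 2 * expR 1.
pose C2 : R := 4 + 1600 * 800 * expR (10 * 800) + 1601.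
have C10 : 0 < C1 by rewrite addr_gt0 // mulr_gt0 ?expR_gt0 // mulr_gt0 // exprn_gt0.
have C20 : 0 < C2 by rewrite /C2; have := expR_gt0 (10 * 800 : R); lra.
exists (C1 + C2), (320 / (zeta ^+ 2 * a ^+ 2)); split; first by rewrite addr_gt0.
move=> n p L p01 nL L0.
have L_large : 320 <= zeta ^+ 2 * a ^+ 2 * L by rewrite mulrC -ler_pdivrMr.
have L320 := L_ge320 theta01 erefl erefl erefl L_large.
rewrite gnp_prob_compl mulrDl.
have e0 : 0 < expR (- (L / 10)) by apply: expR_gt0.
have [dL|/ltW dL] := leP (40 * L) (p * n%:R).
  apply: le_trans (Ex_stp_fail_dense theta01 erefl erefl erefl p01 nL L_large dL) _.
  apply: (@le_trans _ _ (C1 * expR (- (L / 10)))); last by rewrite lerDl mulr_ge0 // ltW.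
  by rewrite ler_wpM2l ?(ltW C10) // ler_expR; lra.
apply: le_trans (Ex_stp_fail_sparse theta01 erefl erefl erefl p01 nL L_large theta_eq dL) _.
by rewrite lerDr mulr_ge0 // ltW.
Qed.

End Final.

(* Passage to the limit *)
From mathcomp Require Import all_classical all_reals all_analysis.
Import numFieldNormedType.Exports.
Local Open Scope classical_set_scope.

Theorem theorem2p1 (R : realType) (p : nat -> R) :
  (forall n, 0 <= p n <= 1) ->
  (fun n : nat => @gnp_prob R n (p n) (@stp_event n)) @ \oo --> (1 : R).
Proof.
move=> p01; have [C [L0 [C0 H]]] := gnp_prob_stp_event R.
(* Since [expR (L / 10) >= L / 10], the failure bound drops below [eps] once [L >= 10 * C / eps]. *)
apply/cvgrPdist_le => eps eps0; pose M := Num.max L0 (10 * C / eps).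
exists (Num.truncn (expR M)).+1 => // n /= Nn.
have Mn : expR M <= n%:R.
  by apply: le_trans (ltW (truncnS_gt _)) _; rewrite ler_nat.
have n0 : 0 < n%:R :> R by apply: lt_le_trans Mn; apply: expR_gt0.
have nL : n%:R = expR (ln n%:R) :> R by rewrite lnK.
have LM : M <= ln n%:R by rewrite -ler_expR -nL.
rewrite ger0_norm; last first.
  by rewrite gnp_prob_compl Ex_ge0 // => E _; rewrite ler0n.
apply: le_trans (H _ _ _ (p01 n) nL (le_trans _ LM)) _; first by rewrite le_max lexx.
rewrite expRN -ler_pdivlMl // -[leRHS]invrK lef_pV2 ?posrE ?expR_gt0 //; last first.
  by rewrite invr_gt0 mulr_gt0 ?invr_gt0.
rewrite invfM invrK; apply: le_trans (expR_ge1Dx _).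
have : 10 * C / eps <= ln n%:R by apply: le_trans LM; rewrite le_max lexx orbT.
lra.
Qed.
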